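(* Let $p,r,s\in(1,\infty)$ satisfy $\frac1p=\frac1r+\frac1s$. There exists a positive constant $K$, not depending on $h$ (nor on the quantization grids), such that $$\max_{i\in\mathbb{I}_q}\big\|\bar Y_{t_k}^i-\hat Y_k^i\big\|_p\;\le\;K\sum_{\ell=k}^m\big(1+\|X_0\|_r+\|\hat X_\ell\|_r\big)\,\big\|\bar X_{t_\ell}-\hat X_\ell\big\|_s$$ for every $k=0,\dots,m$.
   Context: Fix $T\in(0,\infty)$, a filtered probability space $(\Omega,\mathcal{F},\mathbb{F}=(\mathcal{F}_t)_{t\ge 0},\mathbb{P})$ satisfying the usual conditions, a standard $d$-dimensional $\mathbb{F}$-Brownian motion $W$, and the finite set of regimes $\mathbb{I}_q=\{1,\dots,q\}$. Write $f_i=f(\cdot,i)$, $g_i=g(\cdot,i)$, $c_{ij}=c(\cdot,i,j)$, and $\|Y\|_p=(\mathbb{E}|Y|^p)^{1/p}$ for a random variable $Y$. Standing assumptions: the diffusion is uncontrolled, with Lipschitz coefficients $b:\mathbb{R}^d\to\mathbb{R}^d$ and $\sigma:\mathbb{R}^d\to\mathbb{R}^{d\times d}$; $f_i,g_i,c_{ij}:\mathbb{R}^d\to\mathbb{R}$ are Lipschitz for all $i,j\in\mathbb{I}_q$; the switching costs satisfy $c_{ii}=0$, $\inf_x c_{ij}(x)>0$ for $j\ne i$, and $\inf_x[c_{ij}(x)+c_{jk}(x)-c_{ik}(x)]>0$ for $j\neq i,k$; and $g_i(x)\ge\max_{j}[g_j(x)-c_{ij}(x)]$ for all $x,i$. Euler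 scheme: $m\ge1$ is an integer, $h=T/m\le1$, $t_k=kh$; $X_0$ is an $\mathcal{F}_0$-measurable $\mathbb{R}^d$-valued random variable; $\vartheta_{k+1}=(W_{t_{k+1}}-W_{t_k})/\sqrt h$; $F^h(x,w)=x+b(x)h+\sigma(x)\sqrt h\,w$; $\bar X_0=X_0$ and $\bar X_{t_{k+1}}=F^h(\bar X_{t_k},\vartheta_{k+1})$, $k=0,\dots,m-1$. The transition kernel is $P^h\varphi(x)=\mathbb{E}[\varphi(F^h(x,\vartheta))]$ with $\vartheta\sim\mathcal{N}(0,I_d)$. Discrete-time value functions: $\bar v_i(t_m,\cdot)=g_i$ and $\bar v_i(t_k,\cdot)=\max_{j\in\mathbb{I}_q}[P^h\bar v_j(t_{k+1},\cdot)+hf_j-c_{ij}]$, $k=0,\dots,m-1$. (These are the value functions of the optimal switching problem for the Euler chain with switching times in $\{t_0,\dots,t_m\}$.) Set $\bar Y_{t_k}^i=\bar v_i(t_k,\bar X_{t_k})$. Marginal quantization: for each $k=0,\dots,m$, $\Gamma_k=\{x_k^1,\dots,x_k^{N_k}\}\subset\mathbb{R}^d$ is a given finite grid and $\hat X_k=\mathrm{Proj}_k(\bar X_{t_k})$, where $\mathrm{Proj}_k$ is a (measurable) closest-neighbour projection on $\Gamma_k$. The discrete transitions are $\hat P_k\varphi(x_k^l)=\mathbb{E}[\varphi(\hat X_{k+1})\mid\hat X_k=x_k^l]=\sum_{l'}\pi_k^{ll'}\varphi(x_{k+1}^{l'})$ with $\pi_k^{ll'}=\mathbb{P}[\hat X_{k+1}=x_{k+1}^{l'}\mid\hat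 X_k=x_k^l]$. Define $\hat v_k^i$ on $\Gamma_k$ by $\hat v_m^i=g_i$ and $\hat v_k^i=\max_{j\in\mathbb{I}_q}[\hat P_k\hat v_{k+1}^j+hf_j-c_{ij}]$, $k=0,\dots,m-1$, and set $\hat Y_k^i=\hat v_k^i(\hat X_k)$. *)

(* Defs.v *)
From HB Require Import structures.
From mathcomp Require Import all_boot all_order all_algebra finmap.
From mathcomp Require Import all_classical all_reals all_analysis.

Set Implicit Arguments.
Unset Strict Implicit.
Unset Printing Implicit Defensive.

Import Order.TTheory GRing.Theory Num.Theory.
Import numFieldNormedType.Exports.

Local Open Scope classical_set_scope.
Local Open Scope ring_scope.

(* Column vectors carry the product sigma-algebra, exactly as [n.-tuple T] does
   in the library; on ['cV[R]_n] it is the Borel sigma-algebra. *)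
Definition measure_cV_display : measure_display -> measure_display.
Proof. exact. Qed.

Section measurable_cV.
Context {disp : measure_display} {T : measurableType disp}.
Variable n : nat.

Let coors : 'I_n -> 'cV[T]_n -> T := fun i v => v i ord0.

Let cV_set0 : g_sigma_preimage coors set0.
Proof. exact: sigma_algebra0. Qed.

Let cV_setC A : g_sigma_preimage coors A -> g_sigma_preimage coors (~` A).
Proof. exact: sigma_algebraC. Qed.

Let cV_bigcup (F : (set 'cV[T]_n)^nat) :
  (forall i, g_sigma_preimage coors (F i)) ->
  g_sigma_preimage coors (\bigcup_i (F i)).
Proof. exact: sigma_algebra_bigcup. Qed.

HB.instance Definition _ := @isMeasurable.Build (measure_cV_display disp)
  'cV[T]_n (g_sigma_preimage coors) cV_set0 cV_setC cV_bigcup.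

End measurable_cV.

Lemma measurable_cVP d1 d2 (T1 : measurableType d1) (T2 : measurableType d2) n
    (f : T1 -> 'cV[T2]_n) :
  (forall i, measurable_fun [set: T1] (fun x => f x i ord0)) ->
  measurable_fun [set: T1] f.
Proof.
move=> mf.
suff pS : g_sigma_preimage (fun i => (fun v : 'cV[T2]_n => v i ord0) \o f)
    `<=` measurable.
  by move: pS; rewrite g_sigma_preimage_comp => pS _ A mA; apply: pS; exists A.
apply: smallest_sub; first exact: sigma_algebra_measurable.
case: n => [|n] in f mf *; first by rewrite big_ord0.
rewrite -bigcup_mkord_ord; apply: bigcup_sub => i Ii.
by move=> A [B mB <-]; exact: mf.
Qed.

Lemma measurable_coord disp (T : measurableType disp) n (i : 'I_n) :
  measurable_fun [set: 'cV[T]_n] (fun v => v i ord0).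
Proof.
move=> _ Y mY; rewrite setTI; apply: sub_sigma_algebra => /=.
rewrite -bigcup_seq/=; exists i => /=; first by rewrite mem_index_enum.
by exists Y => //; rewrite setTI.
Qed.

Section std_gaussian.
Context {R : realType}.

Definition cV_cons n (u : measurableTypeR R * 'cV[R]_n) : 'cV[R]_n.+1 :=
  col_mx (u.1%:M : 'M[R]_1) u.2.

Lemma measurable_cV_cons n :
  measurable_fun [set: measurableTypeR R * 'cV[R]_n] (@cV_cons n).
Proof.
apply: measurable_cVP => i; rewrite /cV_cons.
have [j|j] := @splitP 1 n i.
  move=> ij; have -> : i = lshift n j by exact: val_inj.
  under eq_fun do rewrite (@col_mxEu _ 1 n) mxE ord1 eqxx mulr1n.
  exact: measurable_fst.
move=> ij; have -> : i = rshift 1 j by exact: val_inj.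
under eq_fun do rewrite (@col_mxEd _ 1 n).
exact: (measurableT_comp (@measurable_coord _ _ n j) measurable_snd).
Qed.

HB.instance Definition _ n :=
  isMeasurableFun.Build _ _ _ _ (@cV_cons n) (@measurable_cV_cons n).

(* N(0, I_n), the product of n copies of N(0, 1) *)
Fixpoint std_gaussian n : probability 'cV[R]_n R :=
  match n with
  | 0 => \d_(0 : 'cV[R]_0)
  | n.+1 => distribution (normal_prob 0 1 \x std_gaussian n)%E
              (@cV_cons n)
  end.

End std_gaussian.

Section stochastic_basis.
Context {R : realType} {disp : measure_display} {Omega : measurableType disp}.
Variable P : probability Omega R.

(* Only the values [F t] with [0 <= t] are relevant. *)
Definition usual_filtration (F : R -> set (set Omega)) : Prop :=
  [/\ forall t, 0 <= t -> sigma_algebra setT (F t) /\ F t `<=` measurable,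
      forall u t, 0 <= u -> u <= t -> F u `<=` F t,
      forall t, 0 <= t -> \bigcap_(u in `]t, +oo[) F u `<=` F t &
      forall N, P.-negligible N -> F 0 N].

Definition sub_measurable d (G : set (set Omega)) (X : Omega -> 'cV[R]_d) :=
  forall A, measurable A -> G (X @^-1` A).

Definition increment d (W : R -> Omega -> 'cV[R]_d) (u t : R) (omega : Omega) :
    'cV[R]_d := W t omega - W u omega.

Definition brownian_motion d (F : R -> set (set Omega))
    (W : R -> Omega -> 'cV[R]_d) : Prop :=
  [/\ forall t, 0 <= t -> sub_measurable (F t) (W t),
      {ae P, forall omega, W 0 omega = 0},
      {ae P, forall omega, {within `[0, +oo[, continuous (W ^~ omega)}},
      forall u t, 0 <= u -> u < t -> forall (B : set Omega) (A : set 'cV[R]_d),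
        F u B -> measurable A ->
        P (B `&` increment W u t @^-1` A) = (P B * P (increment W u t @^-1` A))%E &
      (* W_t - W_u ~ N(0, (t - u) I_d) *)
      forall u t, 0 <= u -> u < t -> forall A : set 'cV[R]_d, measurable A ->
        P (increment W u t @^-1` A) =
        std_gaussian d ((fun z => Num.sqrt (t - u) *: z) @^-1` A)].

End stochastic_basis.

Section lipschitz_and_norms.
Context {R : realType}.

(* Euclidean norm of a vector, Frobenius norm of a matrix; the library's norm
   on matrices is the maximum of the entries. *)
Definition enorm m n (A : 'M[R]_(m, n)) : R :=
  Num.sqrt (\sum_i \sum_j A i j ^+ 2).

Definition lipschitz_mx d m n (f : 'cV[R]_d -> 'M[R]_(m, n)) : Prop :=
  exists L, forall x y, enorm (f x - f y) <= L * enorm (x - y).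

Definition lipschitz_fun d (f : 'cV[R]_d -> R) : Prop :=
  exists L, forall x y, `|f x - f y| <= L * enorm (x - y).

End lipschitz_and_norms.

(* The maximum of [a] over ['I_q]; the initial value of the iteration is one of
   the terms, so that it is irrelevant. *)
Definition maxreg (R : realType) q (i : 'I_q) (a : 'I_q -> R) : R :=
  \big[Num.max/a i]_(j < q) a j.

Section switching.
Context {R : realType} {d q : nat}.
Variables (b : 'cV[R]_d -> 'cV[R]_d) (sigma : 'cV[R]_d -> 'M[R]_d).
Variables (f g : 'I_q -> 'cV[R]_d -> R) (c : 'I_q -> 'I_q -> 'cV[R]_d -> R).

Definition switching_assumptions : Prop :=
  [/\ lipschitz_mx b /\ lipschitz_mx sigma,
      [/\ forall i, lipschitz_fun (f i), forall i, lipschitz_fun (g i) &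
          forall i j, lipschitz_fun (c i j)],
      [/\ forall i x, c i i x = 0,
          forall i j, j != i -> (0 < ereal_inf (range (EFin \o c i j)))%E &
          forall i j k, j != i -> j != k -> (0 < ereal_inf
            (range (fun x => (c i j x + c j k x - c i k x)%:E)))%E] &
      forall x i, maxreg i (fun j => g j x - c i j x) <= g i x].

Definition euler_step (h : R) (x w : 'cV[R]_d) : 'cV[R]_d :=
  x + h *: b x + Num.sqrt h *: (sigma x *m w).

Definition trans_kernel (h : R) (phi : 'cV[R]_d -> R) (x : 'cV[R]_d) : R :=
  \int[std_gaussian d]_w phi (euler_step h x w).

(* Backward dynamic programming over the dates [0, ..., m]: [Q k] is the
   transition operator from date [k] to date [k.+1], and [backward Q h m n i] is
   the value in regime [i] with [n] steps to go, i.e. at date [m - n]. *)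
Fixpoint backward (Q : nat -> ('cV[R]_d -> R) -> 'cV[R]_d -> R) (h : R)
    (m n : nat) (i : 'I_q) (x : 'cV[R]_d) : R :=
  match n with
  | 0 => g i x
  | n'.+1 => maxreg i (fun j =>
      Q (m - n)%N (backward Q h m n' j) x + h * f j x - c i j x)
  end.

Definition vbar (h : R) (m k : nat) : 'I_q -> 'cV[R]_d -> R :=
  backward (fun=> trans_kernel h) h m (m - k).

Section chains.
Context {disp : measure_display} {Omega : measurableType disp}.
Variables (P : probability Omega R) (W : R -> Omega -> 'cV[R]_d).

(* [theta W h k] is the normalized increment over [k h, (k + 1) h]. *)
Definition theta (h : R) (k : nat) (omega : Omega) : 'cV[R]_d :=
  (Num.sqrt h)^-1 *: increment W (k%:R * h) (k.+1%:R * h) omega.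

Fixpoint Xbar (h : R) (X0 : Omega -> 'cV[R]_d) (k : nat) (omega : Omega) :
    'cV[R]_d :=
  match k with
  | 0 => X0 omega
  | k'.+1 => euler_step h (Xbar h X0 k' omega) (theta h k' omega)
  end.

Definition Ybar (h : R) (m : nat) (X0 : Omega -> 'cV[R]_d) (k : nat)
    (i : 'I_q) (omega : Omega) : R :=
  vbar h m k i (Xbar h X0 k omega).

(* A measurable closest-neighbour projection on the grid [G]. *)
Definition nearest_proj (G : {fset 'cV[R]_d}) (pr : 'cV[R]_d -> 'cV[R]_d) :
    Prop :=
  [/\ measurable_fun [set: 'cV[R]_d] pr,
      forall x, pr x \in G &
      forall x y, y \in G -> enorm (x - pr x) <= enorm (x - y)].

Variables (h : R) (m : nat) (X0 : Omega -> 'cV[R]_d).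
Variables (Gamma : nat -> {fset 'cV[R]_d}).
Variables (Proj : nat -> 'cV[R]_d -> 'cV[R]_d).

Definition Xhat (k : nat) (omega : Omega) : 'cV[R]_d :=
  Proj k (Xbar h X0 k omega).

(* Conditional probability of [Xhat k.+1 = y] given [Xhat k = x]; it is 0 when
   the conditioning event is null. *)
Definition trans_weight (k : nat) (x y : 'cV[R]_d) : R :=
  fine (P (Xhat k @^-1` [set x] `&` Xhat k.+1 @^-1` [set y])) /
  fine (P (Xhat k @^-1` [set x])).

Definition quant_kernel (k : nat) (phi : 'cV[R]_d -> R) (x : 'cV[R]_d) : R :=
  \sum_(y <- Gamma k.+1) trans_weight k x y * phi y.

(* Meaningful on the grid [Gamma k] only. *)
Definition vhat (k : nat) : 'I_q -> 'cV[R]_d -> R :=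
  backward quant_kernel h m (m - k).

Definition Yhat (k : nat) (i : 'I_q) (omega : Omega) : R :=
  vhat k i (Xhat k omega).

End chains.

End switching.

Section Lp_norms.
Local Open Scope ereal_scope.
Context {R : realType} {disp : measure_display} {Omega : measurableType disp}.
Variable P : probability Omega R.

Definition normRV (p : R) (Y : Omega -> R) : \bar R := 'N[P]_p%:E[EFin \o Y].

Definition normRVec d (p : R) (X : Omega -> 'cV[R]_d) : \bar R :=
  normRV p (fun omega => enorm (X omega)).

End Lp_norms.

(* Main.v *)
Require Import Defs.
From HB Require Import structures.
From mathcomp Require Import all_boot all_order all_algebra finmap.
From mathcomp Require Import all_classical all_reals all_analysis.
From mathcomp Require Import measurable_realfun ring lra.

Import Order.TTheory GRing.Theory Num.Theory.
Import numFieldNormedType.Exports.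

Local Open Scope classical_set_scope.
Local Open Scope ring_scope.

Set Implicit Arguments.
Unset Strict Implicit.
Unset Printing Implicit Defensive.

(** Two facts carry the proof.

    Regularity. The value functions of the Euler chain satisfy
      |v(x) - v(y)| <= C (1 + |y|) |x - y|
    with [C] independent of the step [h], the date and the regime, and the same
    holds after one application of the transition kernel
    ([value_uniform_regularity]). A direct induction fails: each of the [m]
    dates could add the Lipschitz constant of a switching cost. Switching is
    limited because each switch costs at least [c0 > 0], and this is expressed
    without strategies, by a Lyapunov function. Let [j] be the optimal regime at
    [x]; its use at [y] bounds [v(y)] from below. When [j] differs from the
    current regime, the continuation value at [x] exceeds the current value by
    at least [c0], up to terms of order [h]. With the bracket
    <x> = sqrt (1 + |x|^2) and [Gam <x>] a bound for [|v|], the function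
      S = v(x) + Gam <x> + t |x - y|
    is nonnegative and gains [c0] in mean at each switch, so that its mean
    square gains at least [2 c0 t |x - y|]: this pays for the term
    [L t |x - y|] that comes from the switching cost. Hence
      t (v(x) - v(y)) <= beta (<x>^2 + t^2 |x - y|^2) - lam S^2
    propagates backwards for every [t >= 0], with [lam = L / (2 c0)] and [beta]
    multiplied by [1 + O(h)] per date ([switching_lyapunov]). The choice
    [t = <x> / |x - y|] gives the modulus. It can be written with the bracket of
    either point: the brackets are comparable when [|x - y| <= 1], and otherwise
    linear growth suffices ([value_loc_lipschitz]).

    Propagation. Put [D_k = max_i |Y_k^i - Y'_k^i|] and
    [e_k = <X'_k> |X_k - X'_k|]. By the Markov property of the Euler chain
    ([one_step_expectation]) and the regularity above,
      D_k <= 3 C e_k + E[C e_k + D_(k+1) | X'_k]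
    almost surely ([val_err_step]). Conditional expectations contract Lebesgue
    norms ([normRV_cell_mean]), so that the norms of the local errors add up
    without amplification ([normRV_val_err]); Hoelder's inequality bounds each
    norm by the product in the statement ([normRV_loc_err]). The quantized chain
    takes finitely many values, hence conditioning on it is averaging over
    cells. *)

(** * Euclidean norms *)

Section euclidean.
Context {R : realType}.
Implicit Types (m n d : nat).

Lemma CauchySchwarz_sum (I : finType) (a b : I -> R) :
  (\sum_i a i * b i) ^+ 2 <= (\sum_i a i ^+ 2) * (\sum_i b i ^+ 2).
Proof.
(* Lagrange's identity: this double sum is twice the defect. *)
have : 0 <= \sum_i \sum_j (a i * b j - a j * b i) ^+ 2.
  by apply: sumr_ge0 => i _; apply: sumr_ge0 => j _; exact: sqr_ge0.
set A := \sum_i a i ^+ 2; set B := \sum_i b i ^+ 2; set C := \sum_i a i * b i.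
have -> : \sum_i \sum_j (a i * b j - a j * b i) ^+ 2 =
    \sum_i (a i ^+ 2 * B - 2 * (a i * b i) * C + b i ^+ 2 * A).
  apply: eq_bigr => i _; rewrite !mulr_sumr -sumrB -big_split/=.
  by apply: eq_bigr => j _; ring.
rewrite 2!big_split/= sumrN -!mulr_suml -mulr_sumr -/A -/B -/C; lra.
Qed.

Definition dotv d (u v : 'cV[R]_d) : R := \sum_i u i ord0 * v i ord0.

Lemma enorm_ge0 m n (A : 'M[R]_(m, n)) : 0 <= enorm A.
Proof. exact: sqrtr_ge0. Qed.

Lemma sqr_enorm m n (A : 'M[R]_(m, n)) :
  enorm A ^+ 2 = \sum_i \sum_j A i j ^+ 2.
Proof.
rewrite sqr_sqrtr//; apply: sumr_ge0 => i _; apply: sumr_ge0 => j _.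
exact: sqr_ge0.
Qed.

Lemma sqr_enormv d (u : 'cV[R]_d) : enorm u ^+ 2 = \sum_i u i ord0 ^+ 2.
Proof. by rewrite sqr_enorm; under eq_bigr do rewrite big_ord1. Qed.

Lemma sqr_enorm_dot d (u : 'cV[R]_d) : enorm u ^+ 2 = dotv u u.
Proof. by rewrite sqr_enormv; apply: eq_bigr => i _; rewrite expr2. Qed.

Lemma dotvDr d (u v w : 'cV[R]_d) : dotv u (v + w) = dotv u v + dotv u w.
Proof.
by rewrite /dotv -big_split/=; apply: eq_bigr => i _; rewrite mxE mulrDr.
Qed.

Lemma dotvDl d (u v w : 'cV[R]_d) : dotv (v + w) u = dotv v u + dotv w u.
Proof.
by rewrite /dotv -big_split/=; apply: eq_bigr => i _; rewrite mxE mulrDl.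
Qed.

Lemma dotvC d (u v : 'cV[R]_d) : dotv u v = dotv v u.
Proof. by apply: eq_bigr => i _; rewrite mulrC. Qed.

Lemma dotvZr d (u v : 'cV[R]_d) a : dotv u (a *: v) = a * dotv u v.
Proof.
by rewrite /dotv mulr_sumr; apply: eq_bigr => i _; rewrite mxE mulrCA.
Qed.

Lemma dotv_le d (u v : 'cV[R]_d) : `|dotv u v| <= enorm u * enorm v.
Proof.
rewrite -(@ler_pXn2r _ 2)// ?nnegrE ?mulr_ge0 ?enorm_ge0//.
rewrite real_normK ?num_real// exprMn !sqr_enormv.
exact: CauchySchwarz_sum.
Qed.

Lemma sqr_enormD d (u v : 'cV[R]_d) :
  enorm (u + v) ^+ 2 = enorm u ^+ 2 + 2 * dotv u v + enorm v ^+ 2.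
Proof.
rewrite !sqr_enorm_dot dotvDr !dotvDl (dotvC v u); lra.
Qed.

Lemma enormD d (u v : 'cV[R]_d) : enorm (u + v) <= enorm u + enorm v.
Proof.
rewrite -(@ler_pXn2r _ 2)// ?nnegrE ?addr_ge0 ?enorm_ge0// sqr_enormD.
have := le_trans (ler_norm _) (dotv_le u v).
by rewrite sqrrD; lra.
Qed.

Lemma enormZ m n a (A : 'M[R]_(m, n)) : enorm (a *: A) = `|a| * enorm A.
Proof.
apply/eqP; rewrite -(@eqrXn2 _ 2)// ?mulr_ge0 ?enorm_ge0//; apply/eqP.
rewrite exprMn !sqr_enorm real_normK ?num_real// mulr_sumr.
apply: eq_bigr => i _; rewrite mulr_sumr; apply: eq_bigr => j _.
by rewrite mxE exprMn.
Qed.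

Lemma enormN m n (A : 'M[R]_(m, n)) : enorm (- A) = enorm A.
Proof. by rewrite -scaleN1r enormZ normrN1 mul1r. Qed.

Lemma enormBC m n (A B : 'M[R]_(m, n)) : enorm (A - B) = enorm (B - A).
Proof. by rewrite -enormN opprB. Qed.

Lemma enorm0 m n : enorm (0 : 'M[R]_(m, n)) = 0.
Proof. by rewrite -(scale0r 0) enormZ normr0 mul0r. Qed.

Lemma enorm_eq0 d (u : 'cV[R]_d) : enorm u = 0 -> u = 0.
Proof.
move=> u0; have /eqP := sqr_enormv u; rewrite u0 expr0n/= eq_sym psumr_eq0.
  move=> /allP /(_ _ (mem_index_enum _)) h; apply/colP => i.
  by have := h i; rewrite implyTb sqrf_eq0 => /eqP ->; rewrite mxE.
by move=> i _; exact: sqr_ge0.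
Qed.

Lemma enorm_mulmx d (A : 'M[R]_d) (w : 'cV[R]_d) :
  enorm (A *m w) <= enorm A * enorm w.
Proof.
rewrite -(@ler_pXn2r _ 2)// ?nnegrE ?mulr_ge0 ?enorm_ge0// exprMn.
rewrite !sqr_enormv sqr_enorm mulr_suml; apply: ler_sum => i _.
by rewrite mxE; exact: CauchySchwarz_sum.
Qed.

Lemma normr_coord_le_enorm m n (A : 'M[R]_(m, n)) i j : `|A i j| <= enorm A.
Proof.
rewrite -(@ler_pXn2r _ 2)// ?nnegrE ?enorm_ge0// sqr_enorm.
rewrite real_normK ?num_real// (bigD1 i)//= (bigD1 j)//= -addrA lerDl.
by rewrite addr_ge0// sumr_ge0// => k _; rewrite ?sumr_ge0// => *;
  rewrite sqr_ge0.
Qed.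

Lemma enorm_le_sum d (u : 'cV[R]_d) : enorm u <= \sum_i `|u i ord0|.
Proof.
have h0 : 0 <= \sum_i `|u i ord0| by exact: sumr_ge0.
rewrite -(@ler_pXn2r _ 2)// ?nnegrE ?enorm_ge0// sqr_enormv expr2.
rewrite mulr_suml; apply: ler_sum => i _.
rewrite -[X in X <= _]ger0_norm ?sqr_ge0// normrX expr2 ler_wpM2l//.
by rewrite (bigD1 i)//= lerDl; exact: sumr_ge0.
Qed.

(** The Japanese bracket, a smooth substitute for [1 + enorm x]. A Gaussian step
    of length [h] may raise the mean of [1 + enorm x] by the order of [sqrt h],
    but multiplies that of the bracket by at most [1 + O(h)]. *)
Definition jap d (x : 'cV[R]_d) : R := Num.sqrt (1 + enorm x ^+ 2).

Lemma sqr_jap d (x : 'cV[R]_d) : jap x ^+ 2 = 1 + enorm x ^+ 2.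
Proof. by rewrite sqr_sqrtr// addr_ge0// sqr_ge0. Qed.

Lemma jap_ge0 d (x : 'cV[R]_d) : 0 <= jap x.
Proof. exact: sqrtr_ge0. Qed.

Lemma jap_ge1 d (x : 'cV[R]_d) : 1 <= jap x.
Proof.
rewrite -(@ler_pXn2r _ 2)// ?nnegrE ?jap_ge0// sqr_jap expr1n lerDl.
exact: sqr_ge0.
Qed.

Lemma enorm_le_jap d (x : 'cV[R]_d) : enorm x <= jap x.
Proof.
rewrite -(@ler_pXn2r _ 2)// ?nnegrE ?jap_ge0 ?enorm_ge0// sqr_jap.
by rewrite lerDr.
Qed.

Lemma jap_le d (x : 'cV[R]_d) : jap x <= 1 + enorm x.
Proof.
have x0 := enorm_ge0 x.
rewrite -(@ler_pXn2r _ 2)// ?nnegrE ?jap_ge0// ?addr_ge0// sqr_jap.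
by rewrite sqrrD expr1n; lra.
Qed.

Lemma jap_triangle d (x y : 'cV[R]_d) : jap x <= jap y + enorm (x - y).
Proof.
have h1 := jap_ge0 y; have h2 := enorm_ge0 (x - y).
rewrite -(@ler_pXn2r _ 2)// ?nnegrE ?jap_ge0// ?addr_ge0// sqrrD !sqr_jap.
rewrite -[in enorm x](subrK y x) (addrC (x - y)) sqr_enormD.
have := le_trans (ler_norm _) (dotv_le y (x - y)).
have := ler_wpM2r h2 (enorm_le_jap y).
lra.
Qed.

End euclidean.

(** * Measurability on column vectors *)

Section measurability.
Context {R : realType}.
Implicit Types (d : nat).

(** Boxes with rational centres and radii are measurable for the product
    sigma-algebra and form a countable base of the topology, so that the open
    preimages of a continuous function are measurable. *)
Lemma measurable_enorm_lipschitz d (phi : 'cV[R]_d -> R) :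
  lipschitz_fun phi -> measurable_fun setT phi.
Proof.
move=> [L Lphi].
apply: (measurability _ (RGenOInfty.measurableE R)) => _ [_ [a ->] <-].
rewrite setTI.
pose box (z : 'cV[rat]_d * nat) : set 'cV[R]_d :=
  [set x | forall i, ball (ratr (z.1 i ord0) : R) (z.2.+1%:R^-1) (x i ord0)].
have mbox z : measurable (box z).
  rewrite (_ : box z = \bigcap_(i in [set: 'I_d])
      ((fun v : 'cV[R]_d => v i ord0) @^-1`
        ball (ratr (z.1 i ord0) : R) (z.2.+1%:R^-1))); last first.
    by apply/seteqP; split => x h i; [move=> _; exact: h|exact: (h i I)].
  apply: fin_bigcap_measurable => //.
  move=> i _; rewrite -[X in measurable X]setTI.
  by apply: measurable_coord => //; exact: measurable_ball.
pose G z := if `[< box z `<=` phi @^-1` `]a, +oo[ >] then box z else set0.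
rewrite (_ : phi @^-1` _ = \bigcup_z G z); last first.
  apply/seteqP; split => [x /=|x [z _]]; last first.
    by rewrite /G; case: asboolP => [h /h|_ []].
  rewrite in_itv/= andbT => ax.
  (* A box of radius less than [e] that contains [x] lies where [phi > a]: two of
     its points differ by less than [2 * e] in each coordinate. *)
  pose e : R := (phi x - a) / (1 + 2 * `|L| * d%:R).
  have den0 : 0 < 1 + 2 * `|L| * d%:R :> R.
    by rewrite ltr_pwDl// !mulr_ge0.
  have e0 : 0 < e by rewrite divr_gt0// subr_gt0.
  have [k ke] : exists k : nat, k.+1%:R^-1 < e.
    have := near_infty_natSinv_lt (PosNum e0).
    by case=> N _ /(_ N (leqnn _)) /= ?; exists N.
  have k0 : 0 < k.+1%:R^-1 :> R by rewrite invr_gt0.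
  have hq i : exists r : rat, `|ratr r - x i ord0| < k.+1%:R^-1.
    have hlt : x i ord0 - k.+1%:R^-1 < x i ord0 + k.+1%:R^-1.
      by move: (_^-1) k0 => K K0; lra.
    have [r /=] := rat_in_itvoo hlt.
    by rewrite in_itv/= => hr; exists r; rewrite ltr_distl.
  have [r hr] := choice hq.
  exists (\col_i r i, k) => //.
  rewrite /G asboolT.
    by move=> i /=; rewrite mxE /ball /=; exact: hr.
  move=> y hy /=; rewrite in_itv/= andbT.
  have hxy : enorm (x - y) <= 2 * e * d%:R.
    apply: (le_trans (enorm_le_sum _)).
    apply: (@le_trans _ _ (\sum_(i < d) 2 * e)); last first.
      by rewrite sumr_const card_ord mulr_natr.
    apply: ler_sum => i _; rewrite !mxE.
    have := hr i; have := hy i; rewrite /= mxE /ball/=.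
    move=> /lt_trans /(_ ke) h1 /lt_trans /(_ ke) h2.
    rewrite (_ : _ - _ = - (ratr (r i) - x i ord0) + (ratr (r i) - y i ord0));
      last by ring.
    by rewrite (le_trans (ler_normD _ _))// normrN; lra.
  have := le_trans (ler_norm _) (Lphi x y).
  have : L * enorm (x - y) <= `|L| * (2 * e * d%:R).
    rewrite (le_trans (ler_wpM2r (enorm_ge0 _) (ler_norm L)))//.
    by rewrite ler_wpM2l.
  have : (1 + 2 * `|L| * d%:R) * e = phi x - a.
    by rewrite /e mulrC divfK// gt_eqF.
  lra.
apply: countable_bigcupT_measurable; first exact: countableP.
by move=> z; rewrite /G; case: ifP.
Qed.

Lemma measurable_enorm d : measurable_fun setT (@enorm R d 1).
Proof.
apply: measurable_enorm_lipschitz; exists 1 => x y; rewrite mul1r ler_norml.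
have := enormD (x - y) y; have := enormD (y - x) x.
by rewrite !subrK (enormBC y x) => h1 h2; apply/andP; split; lra.
Qed.

Lemma measurable_jap d : measurable_fun setT (@jap R d).
Proof.
apply: measurable_enorm_lipschitz; exists 1 => x y; rewrite mul1r ler_norml.
have := jap_triangle x y; have := jap_triangle y x.
by rewrite (enormBC y x) => h1 h2; apply/andP; split; lra.
Qed.

Lemma measurable_lipschitz_mx d m n (phi : 'cV[R]_d -> 'M[R]_(m, n)) i j :
  lipschitz_mx phi -> measurable_fun setT (fun x => phi x i j).
Proof.
move=> [L hL]; apply: measurable_enorm_lipschitz; exists L => x y.
apply: le_trans (hL x y).
by have := normr_coord_le_enorm (phi x - phi y) i j; rewrite !mxE.
Qed.

Lemma measurable_set1_cV d (y : 'cV[R]_d) : measurable [set y].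
Proof.
rewrite (_ : [set y] = \bigcap_(i in [set: 'I_d])
    ((fun v : 'cV[R]_d => v i ord0) @^-1` [set y i ord0])); last first.
  by apply/seteqP; split => [x -> //|x h]; apply/colP => i; exact: (h i I).
apply: fin_bigcap_measurable => //.
by move=> i _; rewrite -[X in measurable X]setTI; apply: measurable_coord.
Qed.

End measurability.

(** * Moments of the Gaussian law *)

Lemma integral_prob_cst {disp} {U : measurableType disp} {R : realType}
  (nu : probability U R) (a : \bar R) : (\int[nu]_x a = a)%E.
Proof.
rewrite (integral_cst nu measurableT a) -[RHS]mule1; congr (_ * _)%E.
exact: probability_setT.
Qed.

Section normal_moments.
Context {R : realType}.
Local Notation mu := (@lebesgue_measure R).
Local Notation N01 := (normal_prob (0 : R) 1).
Local Notation pdf := (@normal_pdf R 0 1).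

(** By uniqueness, the Radon-Nikodym derivative of the law agrees almost everywhere
    with the density. *)
Lemma ge0_integral_normal_prob (phi : R -> R) :
  measurable_fun setT phi -> (forall x, 0 <= phi x) ->
  (\int[N01]_x (phi x)%:E = \int[mu]_x (phi x * pdf x)%:E)%E.
Proof.
move=> mphi phi0.
have dom := normal_prob_dominates (0 : R) 1.
rewrite -(Radon_Nikodym_SigmaFinite.change_of_variables dom)//=; last first.
  exact/measurable_EFinP.
apply: ge0_ae_eq_integral => //=.
- apply: emeasurable_funM; first exact/measurable_EFinP.
  by apply: (measurable_int mu); exact: Radon_Nikodym_SigmaFinite.f_integrable.
- apply/measurable_EFinP/measurable_funM => //.
  exact: measurable_normal_pdf.
- move=> x _; rewrite mule_ge0 ?lee_fin//.
  exact: Radon_Nikodym_SigmaFinite.f_ge0.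
- by move=> x _; rewrite lee_fin mulr_ge0// normal_pdf_ge0.
under [X in ae_eq _ _ _ X]eq_fun do rewrite EFinM.
apply: ae_eqe_mul2l; apply: integral_ae_eq => //=.
- exact: Radon_Nikodym_SigmaFinite.f_integrable.
- apply/measurable_EFinP; exact: measurable_normal_pdf.
- by move=> E _ mE; rewrite -Radon_Nikodym_SigmaFinite.f_integral.
Qed.

(** Since [u <= exp u] at [u = x ^ 2 / 4], the function [x ^ 2 exp (- x ^ 2 / 2)]
    is at most [4 exp (- x ^ 2 / 4)], a multiple of the density of variance 2. *)
Lemma normal_prob_sqr_lty : (\int[N01]_x (x ^+ 2)%:E < +oo)%E.
Proof.
rewrite (@ge0_integral_normal_prob (fun x => x ^+ 2))//; last first.
  by move=> x; exact: sqr_ge0.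
pose c := 4 * normal_peak (1 : R) / normal_peak (Num.sqrt 2).
have s20 : Num.sqrt 2 != 0 :> R by rewrite gt_eqF// sqrtr_gt0.
have p2 : 0 < normal_peak (Num.sqrt 2 : R) by exact: normal_peak_gt0.
have c0 : 0 <= c by rewrite divr_ge0 ?mulr_ge0 ?normal_peak_ge0.
apply: (@le_lt_trans _ _ (\int[mu]_x (c * normal_pdf 0 (Num.sqrt 2) x)%:E)%E).
  apply: ge0_le_integral => //=.
  - by move=> x _; rewrite lee_fin mulr_ge0 ?sqr_ge0// normal_pdf_ge0.
  - apply/measurable_EFinP/measurable_funM; first by [].
    exact: measurable_normal_pdf.
  - by apply/measurable_EFinP/measurable_funM => //; exact: measurable_normal_pdf.
  move=> x _; rewrite lee_fin !normal_pdfE ?oner_eq0// /=.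
  have -> : c * (normal_peak (Num.sqrt 2) * normal_fun 0 (Num.sqrt 2) x) =
      normal_peak 1 * (4 * normal_fun 0 (Num.sqrt 2) x).
    by rewrite mulrA /c divfK ?gt_eqF// -mulrA mulrCA.
  rewrite mulrCA ler_wpM2l ?normal_peak_ge0// /normal_fun subr0 sqr_sqrtr//.
  rewrite expr1n.
  set e := expR (- x ^+ 2 / (2 *+ 2)).
  rewrite (_ : expR (- x ^+ 2 / (1 *+ 2)) = e * e); last first.
    by rewrite -expRD; congr expR; field.
  rewrite mulrA ler_wpM2r ?expR_ge0//.
  have := expR_ge1Dx (x ^+ 2 / (2 *+ 2)).
  have -> : e = (expR (x ^+ 2 / (2 *+ 2)))^-1 by rewrite -expRN /e mulNr.
  move=> h; rewrite ler_pdivrMr ?expR_gt0//.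
  by move: h; move: (expR _) => E; lra.
under eq_integral do rewrite EFinM.
rewrite integralZl//; last exact: integrable_normal_pdf.
by rewrite integral_normal_pdf mule1 ltry.
Qed.

(** The reflection [x |-> - x] exchanges the two integrands and preserves the
    density. *)
Lemma normal_prob_pos_neg :
  (\int[N01]_x (Num.max x 0)%:E = \int[N01]_x (Num.max (- x) 0)%:E)%E.
Proof.
have mid : measurable_fun setT (id : R -> R) by [].
rewrite ge0_integral_normal_prob; last 2 first.
- exact: measurable_maxr.
- by move=> x; rewrite le_max lexx orbT.
rewrite ge0_integral_normal_prob; last 2 first.
- by apply: measurable_maxr => //; exact: measurable_funN.
- by move=> x; rewrite le_max lexx orbT.
pose G x := `|x| * pdf x.
have cG : continuous G.
  move=> x; apply: cvgM; first exact: norm_continuous.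
  exact: continuous_normal_pdf.
transitivity (\int[mu]_(x in `[0%R, +oo[) (G x)%:E)%E.
  rewrite [RHS]integral_mkcond; apply: eq_integral => x _.
  rewrite patchE mem_setE in_itv/= andbT /G.
  by case: leP => x0; [rewrite ger0_norm|rewrite mul0r].
transitivity (\int[mu]_(x in `]-oo, (- 0)%R]) (G x)%:E)%E; last first.
  rewrite [LHS]integral_mkcond; apply: eq_integral => x _.
  rewrite patchE mem_setE in_itv/= oppr0 /G.
  have [x0|x0] := leP x 0; first by rewrite ler0_norm// max_l ?oppr_ge0.
  by rewrite max_r ?mul0r// oppr_le0 ltW.
rewrite ge0_integration_by_substitutionNy//.
- apply: eq_integral => x _; rewrite /G/= normrN; congr (_ * _)%:E.
  by rewrite !normal_pdfE ?oner_eq0// /normal_fun !subr0 sqrrN.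
- exact: continuous_subspaceT.
- by move=> x _; rewrite mulr_ge0// normal_pdf_ge0.
Qed.

Lemma integrable_normal_prob_id : N01.-integrable setT (fun x : R => x%:E).
Proof.
apply/integrableP; split; first exact/measurable_EFinP.
apply: (@le_lt_trans _ _ (\int[N01]_x (1 + x ^+ 2)%:E)%E).
  apply: ge0_le_integral => //=.
  - by apply/measurable_EFinP; exact: normr_measurable.
  - by apply/measurable_EFinP; apply: measurable_funD.
  move=> x _; rewrite lee_fin.
  have := sqr_ge0 (`|x| - 1); have := sqr_ge0 x.
  by rewrite sqrrB1 real_normK ?num_real//; move: (x ^+ 2) `|x| => a b; lra.
under eq_integral do rewrite EFinD.
rewrite ge0_integralD//=; last 2 first.
- by move=> x _; rewrite lee_fin sqr_ge0.
- exact/measurable_EFinP.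
by rewrite integral_prob_cst lte_add_pinfty ?ltry// normal_prob_sqr_lty.
Qed.

Lemma normal_prob_mean0 : (\int[N01]_x x%:E = 0)%E.
Proof.
have h := integrable_normal_prob_id.
rewrite integralE.
have -> : (fun x : R => x%:E)^\+%E = (fun x : R => (Num.max x 0)%:E).
  by apply/funext => x; rewrite funeposE EFin_max.
have -> : (fun x : R => x%:E)^\-%E = (fun x : R => (Num.max (- x) 0)%:E).
  by apply/funext => x; rewrite funenegE EFin_max EFinN.
rewrite normal_prob_pos_neg subee//.
rewrite -normal_prob_pos_neg.
have := integrable_fin_num measurableT (integrable_funepos measurableT h).
by under eq_integral do rewrite funeposE -EFin_max.
Qed.

End normal_moments.

Section gaussian_moments.
Context {R : realType}.
Local Notation N01 := (normal_prob (0 : R) 1).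

Lemma enorm_cV_cons n (u : R) (v : 'cV[R]_n) :
  enorm (cV_cons (u, v)) ^+ 2 = u ^+ 2 + enorm v ^+ 2.
Proof.
rewrite !sqr_enormv /cV_cons (@big_split_ord _ _ _ 1 n)/= big_ord1.
rewrite (@col_mxEu _ 1 n) mxE eqxx mulr1n; congr (_ + _).
by apply: eq_bigr => i _; rewrite (@col_mxEd _ 1 n).
Qed.

Lemma std_gaussian_sqr_lty d :
  (\int[@std_gaussian R d]_w (enorm w ^+ 2)%:E < +oo)%E.
Proof.
have msq n : measurable_fun setT (fun w : 'cV[R]_n => (enorm w ^+ 2)%:E).
  by apply/measurable_EFinP/measurable_funX; exact: measurable_enorm.
elim: d => [|n IHn].
  rewrite (eq_integral (cst 0%E)) ?integral0// => w _.
  by rewrite sqr_enormv big_ord0.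
rewrite ge0_integral_distribution//; last 2 first.
- exact: msq.
- by move=> y; rewrite lee_fin sqr_ge0.
pose G (z : measurableTypeR R * 'cV[R]_n) := (enorm (cV_cons z) ^+ 2)%:E.
have mG : measurable_fun setT G.
  exact: (measurableT_comp (msq n.+1) (@measurable_cV_cons R n)).
have G0 z : (0 <= G z)%E by rewrite lee_fin sqr_ge0.
have E : (\int[(N01 \x std_gaussian n)%E]_z G z
    = \int[N01]_u \int[std_gaussian n]_v G (u, v))%E.
  exact: fubini_tonelli1.
suff : (\int[N01]_u \int[std_gaussian n]_v G (u, v) < +oo)%E.
  by rewrite -E.
rewrite /G {E}.
pose I := (\int[@std_gaussian R n]_w (enorm w ^+ 2)%:E)%E.
rewrite (eq_integral
  (fun u : measurableTypeR R => ((u : R) ^+ 2)%:E + I)%E); last first.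
  move=> u _; rewrite /=.
  under eq_integral do rewrite enorm_cV_cons EFinD.
  rewrite ge0_integralD//=.
  - by rewrite integral_prob_cst.
  - by move=> x _; rewrite lee_fin sqr_ge0.
  - by move=> x _; rewrite lee_fin sqr_ge0.
  - exact: msq.
have I0 : (0 <= I)%E by apply: integral_ge0 => w _; rewrite lee_fin sqr_ge0.
rewrite ge0_integralD//=; last 2 first.
- by move=> x _; rewrite lee_fin sqr_ge0.
- exact/measurable_EFinP.
rewrite lte_add_pinfty ?normal_prob_sqr_lty//.
by rewrite integral_prob_cst.
Qed.

Lemma integrable_std_gaussian_coord d i :
  (@std_gaussian R d).-integrable setT (fun w => (w i ord0)%:E).
Proof.
have mi : measurable_fun setT (fun w : 'cV[R]_d => w i ord0).
  exact: measurable_coord.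
have msq : measurable_fun setT (fun w : 'cV[R]_d => enorm w ^+ 2).
  by apply: measurable_funX; exact: measurable_enorm.
apply/integrableP; split; first exact/measurable_EFinP.
apply: (@le_lt_trans _ _
    (\int[@std_gaussian R d]_w (1 + enorm w ^+ 2)%:E)%E).
  apply: ge0_le_integral => //=.
  - by apply/measurable_EFinP; exact: measurableT_comp.
  - by apply/measurable_EFinP; exact: measurable_funD.
  move=> w _; rewrite lee_fin (le_trans (normr_coord_le_enorm _ _ _))//.
  have := sqr_ge0 (enorm w - 1); have := sqr_ge0 (enorm w).
  by rewrite sqrrB1; move: (enorm w ^+ 2) (enorm w) => a b; lra.
under eq_integral do rewrite EFinD.
rewrite ge0_integralD//=; last 2 first.
- by move=> x _; rewrite lee_fin sqr_ge0.
- exact/measurable_EFinP.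
rewrite lte_add_pinfty ?std_gaussian_sqr_lty//.
by rewrite integral_prob_cst ltry.
Qed.

(** Centring and the finite second moment are the only properties of the Gaussian
    law that the estimates use. *)
Lemma std_gaussian_mean0 d i :
  (\int[@std_gaussian R d]_w (w i ord0)%:E = 0)%E.
Proof.
elim: d i => [[]//|n IHn] i.
have mi : measurable_fun setT (fun w : 'cV[R]_n.+1 => (w i ord0)%:E).
  by apply/measurable_EFinP; exact: measurable_coord.
have int_i := integrable_std_gaussian_coord i.
pose G (z : measurableTypeR R * 'cV[R]_n) := (cV_cons z i ord0)%:E.
have mG : measurable_fun setT G.
  exact: (measurableT_comp mi (@measurable_cV_cons R n)).
have /integrableP[_ hi] := int_i.
have iG : (N01 \x std_gaussian n)%E.-integrable setT G.
  apply/integrableP; split => //.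
  move: hi; rewrite ge0_integral_distribution//.
  by do 2 apply: measurableT_comp => //; exact: measurable_coord.
rewrite integral_distribution//.
transitivity (\int[N01]_u \int[std_gaussian n]_v G (u, v))%E.
  by rewrite -integral12_prod_meas1.
rewrite /G; have [j|j] := @splitP 1 n i => ij.
- have {}ij : i = lshift n j by exact: val_inj.
  rewrite -[RHS](@normal_prob_mean0 R); apply: eq_integral => u _.
  rewrite (eq_integral (fun=> u%:E)); last first.
    by move=> v _; rewrite ij /cV_cons (@col_mxEu _ 1 n) mxE ord1 eqxx mulr1n.
  exact: integral_prob_cst.
- have {}ij : i = rshift 1 j by exact: val_inj.
  rewrite (eq_integral (cst 0%E)) ?integral0// => u _; rewrite -(IHn j).
  by apply: eq_integral => v _; rewrite ij /cV_cons (@col_mxEd _ 1 n).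
Qed.

End gaussian_moments.

(** * Gaussian means of functions of linear growth *)

Section linear_growth.
Context {R : realType} {d : nat}.
Local Notation gam := (@std_gaussian R d).
Implicit Types (phi psi : 'cV[R]_d -> R).

(** The functions averaged along the scheme belong to this class or are products
    of two of its members. The class is stable under linear combinations and
    under composition with a step, and such products are integrable. *)
Definition lin_growth phi : Prop :=
  measurable_fun setT phi /\ exists C, forall w, `|phi w| <= C * (1 + enorm w).

Lemma lin_growth_enorm : lin_growth (@enorm R d 1).
Proof.
split; first exact: measurable_enorm.
by exists 1 => w; rewrite mul1r ger0_norm ?enorm_ge0// lerDr.
Qed.

Lemma lin_growth_cst a : lin_growth (fun=> a).
Proof.
split => //; exists `|a| => w.
by rewrite ler_peMr// lerDl enorm_ge0.
Qed.

Lemma lin_growthD phi psi : lin_growth phi -> lin_growth psi ->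
  lin_growth (fun w => phi w + psi w).
Proof.
move=> [mphi [C hC]] [mpsi [C' hC']]; split; first exact: measurable_funD.
exists (C + C') => w; rewrite (le_trans (ler_normD _ _))// mulrDl.
exact: lerD.
Qed.

Lemma lin_growthZ a phi : lin_growth phi -> lin_growth (fun w => a * phi w).
Proof.
move=> [mphi [C hC]]; split; first exact: measurable_funM.
by exists (`|a| * C) => w; rewrite normrM -mulrA ler_wpM2l.
Qed.

Lemma lin_growthB phi psi : lin_growth phi -> lin_growth psi ->
  lin_growth (fun w => phi w - psi w).
Proof.
move=> hphi hpsi; have := lin_growthD hphi (lin_growthZ (-1) hpsi).
by under eq_fun do rewrite mulN1r.
Qed.

Lemma integrable_std_gaussian_quad phi C : measurable_fun setT phi ->
  (forall w, `|phi w| <= C * (1 + enorm w) ^+ 2) ->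
  gam.-integrable setT (EFin \o phi).
Proof.
move=> mphi hC.
have msq : measurable_fun setT (fun w : 'cV[R]_d => enorm w ^+ 2).
  by apply: measurable_funX; exact: measurable_enorm.
have i2 : gam.-integrable setT (EFin \o (fun w => 1 + enorm w ^+ 2)).
  apply/integrableP; split.
    by apply/measurable_EFinP; exact: measurable_funD.
  under eq_integral => w _ do rewrite /= ger0_norm ?addr_ge0 ?sqr_ge0// EFinD.
  rewrite ge0_integralD//=; last 2 first.
  - by move=> x _; rewrite lee_fin sqr_ge0.
  - exact/measurable_EFinP.
  by rewrite lte_add_pinfty ?std_gaussian_sqr_lty// integral_prob_cst ltry.
apply: (le_integrable measurableT _ _ (integrableZl measurableT (2 * C) i2)).
- exact/measurable_EFinP.
- move=> w _; rewrite /= lee_fin normrM.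
  apply: (le_trans (hC w)).
  have C0 : 0 <= C.
    have := le_trans (normr_ge0 _) (hC 0).
    by rewrite enorm0 addr0 expr1n mulr1.
  rewrite (ger0_norm (mulr_ge0 _ C0))//.
  have w0 := enorm_ge0 w.
  rewrite ger0_norm ?addr_ge0 ?sqr_ge0// [2 * C]mulrC -mulrA ler_wpM2l//.
  by have := sqr_ge0 (1 - enorm w); rewrite sqrrB sqrrD expr1n; lra.
Qed.

Lemma lin_growth_integrableM phi psi : lin_growth phi -> lin_growth psi ->
  gam.-integrable setT (EFin \o (fun w => phi w * psi w)).
Proof.
move=> [mphi [C hC]] [mpsi [C' hC']].
apply: (@integrable_std_gaussian_quad _ (C * C')).
  exact: measurable_funM.
by move=> w; rewrite normrM expr2 mulrACA ler_pM.
Qed.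

Lemma lin_growth_integrable phi : lin_growth phi ->
  gam.-integrable setT (EFin \o phi).
Proof.
move=> hphi; have := lin_growth_integrableM hphi (lin_growth_cst 1).
by congr integrable; apply/funext => w; rewrite /= mulr1.
Qed.

Lemma lin_growth_integrable_sqr phi : lin_growth phi ->
  gam.-integrable setT (EFin \o (fun w => phi w ^+ 2)).
Proof. by move=> hphi; exact: lin_growth_integrableM. Qed.

Lemma lin_growth_coord i : lin_growth (fun w : 'cV[R]_d => w i ord0).
Proof.
split; first exact: measurable_coord.
exists 1 => w; rewrite mul1r (le_trans (normr_coord_le_enorm _ _ _))//.
by rewrite lerDr.
Qed.

Lemma lin_growth_sum (I : finType) (a : I -> 'cV[R]_d -> R) :
  (forall i, lin_growth (a i)) -> lin_growth (fun w => \sum_i a i w).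
Proof.
move=> ha; split; first by apply: measurable_sum => i; exact: (ha i).1.
have /choice[C hC] : forall i, exists C, forall w, `|a i w| <= C * (1 + enorm w).
  by move=> i; exact: (ha i).2.
exists (\sum_i C i) => w; rewrite mulr_suml.
by apply: (le_trans (ler_norm_sum _ _ _)); exact: ler_sum.
Qed.

Local Notation E phi := (\int[gam]_w phi w).

Lemma gaussE_cst a : E (fun=> a) = a.
Proof. by rewrite /Rintegral integral_prob_cst. Qed.

Lemma gaussED phi psi : gam.-integrable setT (EFin \o phi) ->
  gam.-integrable setT (EFin \o psi) ->
  E (fun w => phi w + psi w) = E phi + E psi.
Proof. exact: RintegralD. Qed.

Lemma gaussEZ a phi : gam.-integrable setT (EFin \o phi) ->
  E (fun w => a * phi w) = a * E phi.
Proof. exact: RintegralZl. Qed.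

Lemma gaussE_le phi psi : gam.-integrable setT (EFin \o phi) ->
  gam.-integrable setT (EFin \o psi) ->
  (forall w, phi w <= psi w) -> E phi <= E psi.
Proof. by move=> hphi hpsi le; apply: le_Rintegral. Qed.

Lemma gaussE_dot (u : 'cV[R]_d) : E (fun w => dotv u w) = 0.
Proof.
have key (s : seq 'I_d) : lin_growth (fun w : 'cV[R]_d =>
    \sum_(i <- s) u i ord0 * w i ord0) /\
    E (fun w => \sum_(i <- s) u i ord0 * w i ord0) = 0.
  elim: s => [|i s [lg IHs]].
    under eq_fun do rewrite big_nil.
    by split; [exact: lin_growth_cst|rewrite gaussE_cst].
  have li := lin_growthZ (u i ord0) (lin_growth_coord i).
  under eq_fun do rewrite big_cons.
  split; first exact: lin_growthD.
  rewrite gaussED ?IHs ?addr0; [|exact: lin_growth_integrable..].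
  rewrite gaussEZ; last by apply: lin_growth_integrable; exact: lin_growth_coord.
  by rewrite /Rintegral std_gaussian_mean0 mulr0.
exact: (key _).2.
Qed.

Definition gauss_sqr : R := E (fun w => enorm w ^+ 2).

Lemma gauss_sqr_ge0 : 0 <= gauss_sqr.
Proof. by apply: Rintegral_ge0 => w _; exact: sqr_ge0. Qed.

End linear_growth.

(** * One Gaussian step *)

Section affine_step.
Context {R : realType} {d : nat}.
Local Notation gam := (@std_gaussian R d).
Local Notation E phi := (\int[gam]_w phi w).

Lemma dotv_mulmx (B : 'M[R]_d) (v w : 'cV[R]_d) :
  dotv v (B *m w) = dotv (B^T *m v) w.
Proof.
have dotE (x y : 'cV[R]_d) : dotv x y = (x^T *m y) ord0 ord0.
  by rewrite mxE; apply: eq_bigr => i _; rewrite mxE.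
by rewrite !dotE mulmxA trmx_mul trmxK.
Qed.

Lemma lipschitz_lin_growth (phi : 'cV[R]_d -> R) :
  lipschitz_fun phi -> lin_growth phi.
Proof.
move=> hphi; split; first exact: measurable_enorm_lipschitz.
have [L hL] := hphi; exists (`|phi 0| + `|L|) => w.
have := hL w 0; rewrite subr0 => h1.
have h2 : `|phi w| <= `|phi w - phi 0| + `|phi 0|.
  by rewrite (le_trans _ (ler_normD _ _))// subrK.
have w0 := enorm_ge0 w.
have := ler_wpM2r w0 (ler_norm L).
have := mulr_ge0 (normr_ge0 (phi 0)) w0.
have := normr_ge0 L.
lra.
Qed.

Variables (u a : 'cV[R]_d) (B : 'M[R]_d) (h : R).
Hypotheses (h0 : 0 <= h) (h1 : h <= 1).

Let Z (w : 'cV[R]_d) : 'cV[R]_d := u + h *: a + Num.sqrt h *: (B *m w).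

Lemma lin_growth_affine (phi : 'cV[R]_d -> R) :
  lin_growth phi -> lin_growth (fun w => phi (Z w)).
Proof.
move=> [mphi [C hC]]; split.
  apply: (measurableT_comp mphi); apply: measurable_cVP => i.
  rewrite [X in measurable_fun _ X](_ : _ = fun w :
      'cV[R]_d => (u + h *: a) i ord0 +
      Num.sqrt h * \sum_j B i j * w j ord0); last first.
    by apply/funext => w; rewrite /Z !mxE.
  apply: measurable_funD => //; apply: measurable_funM => //.
  apply: measurable_sum => j; apply: measurable_funM => //.
  exact: measurable_coord.
have C0 : 0 <= C.
  have := le_trans (normr_ge0 _) (hC 0).
  by rewrite enorm0 addr0 mulr1.
exists (C * (1 + enorm (u + h *: a) + Num.sqrt h * enorm B)) => w.
apply: (le_trans (hC _)); rewrite -mulrA ler_wpM2l//.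
have := enormD (u + h *: a) (Num.sqrt h *: (B *m w)).
rewrite enormZ (ger0_norm (sqrtr_ge0 _)) -/(Z w).
have := ler_wpM2l (sqrtr_ge0 h) (enorm_mulmx B w).
have w0 := enorm_ge0 w; have B0 := enorm_ge0 B.
have := mulr_ge0 (enorm_ge0 (u + h *: a)) w0.
have := mulr_ge0 (sqrtr_ge0 h) B0.
lra.
Qed.

Lemma gaussE_dot_affine v : E (fun w => dotv v (Z w)) = dotv v (u + h *: a).
Proof.
under eq_Rintegral do rewrite /Z dotvDr dotvZr dotv_mulmx.
have lg : lin_growth (fun w => dotv (B^T *m v) w).
  apply: lin_growth_sum => i; apply: lin_growthZ; exact: lin_growth_coord.
have li := lin_growth_integrable lg.
have lc := lin_growth_integrable (lin_growth_cst (d:=d) (dotv v (u + h *: a))).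
rewrite gaussED//; last first.
  by apply: lin_growth_integrable; exact: lin_growthZ.
by rewrite gaussEZ// gaussE_dot mulr0 addr0 gaussE_cst.
Qed.

(** The noise contributes a term of order [h], not [sqrt h], because the cross
    term is centred. *)
Lemma gaussE_sqr_affine_le :
  E (fun w => enorm (Z w) ^+ 2) <=
  enorm (u + h *: a) ^+ 2 + h * enorm B ^+ 2 * gauss_sqr (R := R) (d := d).
Proof.
have lg : lin_growth (fun w => dotv (B^T *m (u + h *: a)) w).
  apply: lin_growth_sum => i; apply: lin_growthZ; exact: lin_growth_coord.
have lgZ := lin_growthZ (2 * Num.sqrt h) lg.
have lc := lin_growth_cst (d:=d) (enorm (u + h *: a) ^+ 2).
have i1 := lin_growth_integrable (lin_growthD lc lgZ).
have isq : gam.-integrable setT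
    (EFin \o (fun w => (h * enorm B ^+ 2) * enorm w ^+ 2)).
  rewrite (_ : _ \o _ = (fun w => (h * enorm B ^+ 2)%:E * (enorm w ^+ 2)%:E)%E)//.
  apply: integrableZl => //.
  exact: (lin_growth_integrable_sqr (lin_growth_enorm (d:=d))).
apply: (@le_trans _ _ (E (fun w => (enorm (u + h *: a) ^+ 2 +
    2 * Num.sqrt h * dotv (B^T *m (u + h *: a)) w) +
    h * enorm B ^+ 2 * enorm w ^+ 2))).
  apply: gaussE_le.
  - apply: lin_growth_integrable_sqr; apply: lin_growth_affine.
    exact: lin_growth_enorm.
  - exact: (integrableD measurableT i1 isq).
  move=> w; rewrite /Z sqr_enormD dotvZr dotv_mulmx mulrA lerD2l.
  rewrite enormZ exprMn real_normK ?num_real// sqr_sqrtr// -mulrA ler_wpM2l//.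
  rewrite -exprMn lerXn2r ?nnegrE ?mulr_ge0 ?enorm_ge0//.
  exact: enorm_mulmx.
rewrite gaussED// gaussED//; [|exact: lin_growth_integrable..].
rewrite gaussE_cst (gaussEZ (2 * Num.sqrt h) (lin_growth_integrable lg)).
rewrite gaussE_dot mulr0 addr0 gaussEZ//.
exact: (lin_growth_integrable_sqr (lin_growth_enorm (d:=d))).
Qed.

(** The bracket [sqrt (e + |z|^2)] is the Euclidean norm of [z] extended by a
    constant coordinate. One family of estimates thus covers the size of a point
    ([e = 1]) and the distance of two points driven by the same noise
    ([e = 0]). *)
Variables (e L : R).
Hypotheses (e0 : 0 <= e).
Let brk (z : 'cV[R]_d) : R := Num.sqrt (e + enorm z ^+ 2).
Hypotheses (L0 : 0 <= L) (ha : enorm a <= L * brk u) (hB : enorm B <= L * brk u).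

Let sqr_brk z : brk z ^+ 2 = e + enorm z ^+ 2.
Proof. by rewrite sqr_sqrtr// addr_ge0// sqr_ge0. Qed.

Let brk_ge0 z : 0 <= brk z. Proof. exact: sqrtr_ge0. Qed.

Let enorm_brk z : enorm z <= brk z.
Proof.
by rewrite -(@ler_pXn2r _ 2)// ?nnegrE ?brk_ge0 ?enorm_ge0// sqr_brk lerDr.
Qed.

Lemma lin_growth_brk : lin_growth brk.
Proof.
split.
  have ms : measurable_fun setT (@Num.sqrt R).
    exact: (continuous_measurable_fun (@sqrt_continuous R)).
  apply: (measurableT_comp ms); apply: measurable_funD => //.
  apply: measurable_funX.
  exact: measurable_enorm.
exists (1 + e) => w; rewrite ger0_norm//.
have w0 := enorm_ge0 w; have ew := mulr_ge0 e0 w0.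
rewrite -(@ler_pXn2r _ 2)// ?nnegrE ?brk_ge0//; last first.
  by rewrite mulr_ge0// addr_ge0.
rewrite sqr_brk exprMn.
have h2 : 1 <= (1 + e) ^+ 2 by rewrite exprn_ege1// lerDl.
have := ler_wpM2r (sqr_ge0 (1 + enorm w)) h2.
have h3 : (1 + e) ^+ 2 <= (1 + e) ^+ 2 * (1 + enorm w) ^+ 2.
  by rewrite ler_peMr ?sqr_ge0// exprn_ege1// lerDl.
have : e <= (1 + e) ^+ 2 by rewrite sqrrD expr1n mul1r; have := sqr_ge0 e; lra.
have ->: (1 + e) ^+ 2 * (1 + enorm w) ^+ 2 = (1 + e) ^+ 2 +
  (1 + e) ^+ 2 * (2 * enorm w + enorm w ^+ 2) by ring.
have : enorm w ^+ 2 <= (1 + e) ^+ 2 * (2 * enorm w + enorm w ^+ 2).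
  have : 0 <= 2 * enorm w + enorm w ^+ 2 by rewrite addr_ge0 ?sqr_ge0 ?mulr_ge0.
  by move=> /(fun p => ler_wpM2r p h2); lra.
lra.
Qed.

Definition moment_rate (l : R) : R :=
  2 * l + l ^+ 2 + l ^+ 2 * gauss_sqr (R := R) (d := d).

Lemma moment_rate_ge0 l : 0 <= l -> 0 <= moment_rate l.
Proof.
move=> l0; rewrite /moment_rate !addr_ge0 ?mulr_ge0 ?sqr_ge0//.
exact: gauss_sqr_ge0.
Qed.

Lemma gaussE_sqr_brk_le :
  E (fun w => brk (Z w) ^+ 2) <= (1 + moment_rate L * h) * brk u ^+ 2.
Proof.
under eq_Rintegral do rewrite sqr_brk.
have i1 := lin_growth_integrable (lin_growth_cst (d:=d) e).
have i2 := lin_growth_integrable_sqr (lin_growth_affine lin_growth_enorm).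
rewrite gaussED// gaussE_cst.
have := gaussE_sqr_affine_le.
have g0 := @gauss_sqr_ge0 R d.
have hn := brk_ge0 u; have hu := enorm_brk u.
have k1 : h * enorm B ^+ 2 * gauss_sqr (R := R) (d := d) <=
    h * (L * brk u) ^+ 2 * gauss_sqr (R := R) (d := d).
  rewrite ler_wpM2r// ler_wpM2l// lerXn2r ?nnegrE ?enorm_ge0//.
  by rewrite mulr_ge0.
have k2 : enorm (u + h *: a) ^+ 2 <= enorm u ^+ 2 +
    2 * h * (L * brk u ^+ 2) + h * (L * brk u) ^+ 2.
  rewrite sqr_enormD dotvZr enormZ exprMn real_normK ?num_real//.
  have d1 : dotv u a <= L * brk u ^+ 2.
    apply: (le_trans (ler_norm _)); apply: (le_trans (dotv_le _ _)).
    rewrite expr2 mulrCA; apply: ler_pM => //; exact: enorm_ge0.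
  have d2 : enorm a ^+ 2 <= (L * brk u) ^+ 2.
    by rewrite lerXn2r ?nnegrE ?enorm_ge0// mulr_ge0.
  have d3 : h ^+ 2 * enorm a ^+ 2 <= h * (L * brk u) ^+ 2.
    apply: ler_pM => //; rewrite ?sqr_ge0// expr2 ler_piMr//.
  have := ler_wpM2l h0 d1.
  lra.
rewrite /moment_rate; have := sqr_brk u.
move: k1 k2; rewrite exprMn.
set n2 := brk u ^+ 2; set g := gauss_sqr.
move=> k1 k2 n2E k3.
have : (1 + (2 * L + L ^+ 2 + L ^+ 2 * g) * h) * n2 = n2 +
   2 * h * (L * n2) + h * (L ^+ 2 * n2) + h * (L ^+ 2 * n2) * g by ring.
lra.
Qed.

(** Jensen's inequality, from the nonnegative variance of the bracket. *)
Lemma gaussE_brk_le : E (fun w => brk (Z w)) <= (1 + moment_rate L * h) * brk u.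
Proof.
have K0 := moment_rate_ge0 L0.
have lgZ := lin_growth_affine lin_growth_brk.
have iZ := lin_growth_integrable lgZ.
have iZ2 := lin_growth_integrable_sqr lgZ.
have := gaussE_sqr_brk_le; set m1 := E (fun w => brk (Z w)).
set m2 := E (fun w => brk (Z w) ^+ 2); set K := 1 + _ => m2le.
have K1 : 1 <= K by rewrite lerDl mulr_ge0.
have m10 : 0 <= m1 by apply: Rintegral_ge0.
have sq : m1 ^+ 2 <= m2.
  have : 0 <= E (fun w => brk (Z w) ^+ 2 + (- (2 * m1) * brk (Z w) + m1 ^+ 2)).
    apply: Rintegral_ge0 => w _.
    by rewrite (_ : _ + _ = (brk (Z w) - m1) ^+ 2) ?sqr_ge0//; ring.
  have lc := lin_growth_cst (d:=d) (m1 ^+ 2).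
  have lZ := lin_growthZ (- (2 * m1)) lgZ.
  rewrite gaussED//; last by apply: lin_growth_integrable; exact: lin_growthD.
  rewrite gaussED//; [|exact: lin_growth_integrable..].
  rewrite gaussEZ// gaussE_cst -/m1 -/m2; lra.
rewrite -(@ler_pXn2r _ 2)// ?nnegrE ?mulr_ge0 ?(le_trans _ K1)//.
rewrite exprMn (le_trans sq)// (le_trans m2le)//.
by rewrite ler_wpM2r ?sqr_ge0// expr2 ler_peMr// (le_trans _ K1).
Qed.

(** A norm lies above its supporting functional at the starting point, and the
    mean of a linear functional only involves the drift. *)
Lemma gaussE_brk_ge : (1 - L * h) * brk u <= E (fun w => brk (Z w)).
Proof.
have lgZ := lin_growth_affine lin_growth_brk.
have iZ := lin_growth_integrable lgZ.
have [u0|un0] := eqVneq (brk u) 0.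
  by rewrite u0 mulr0; apply: Rintegral_ge0.
have up : 0 < brk u by rewrite lt_def un0 brk_ge0.
rewrite -(ler_pM2r up).
have -> : E (fun w => brk (Z w)) * brk u = E (fun w => brk u * brk (Z w)).
  by rewrite gaussEZ// mulrC.
have lgd : lin_growth (fun w => dotv u (Z w)).
  apply: lin_growth_affine; apply: lin_growth_sum => i.
  by apply: lin_growthZ; exact: lin_growth_coord.
apply: (@le_trans _ _ (E (fun w => e + dotv u (Z w)))); last first.
  apply: gaussE_le.
  - apply: lin_growth_integrable; apply: lin_growthD => //.
    exact: lin_growth_cst.
  - by apply: lin_growth_integrable; exact: lin_growthZ.
  move=> w.
  have [|neg] := leP 0 (e + dotv u (Z w)); last first.
    by rewrite (le_trans (ltW neg))// mulr_ge0.
  move=> pos; rewrite -(@ler_pXn2r _ 2)// ?nnegrE ?mulr_ge0//.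
  rewrite exprMn !sqr_brk.
  have dle := dotv_le u (Z w).
  have dle2 : dotv u (Z w) ^+ 2 <= enorm u ^+ 2 * enorm (Z w) ^+ 2.
    rewrite -exprMn -[X in X <= _](real_normK (num_real _)).
    by rewrite lerXn2r ?nnegrE ?mulr_ge0 ?enorm_ge0.
  have := sqr_ge0 (enorm u - enorm (Z w)); rewrite sqrrB => am.
  have d1 := le_trans (ler_norm _) dle.
  have : e * (2 * dotv u (Z w)) <= e * (enorm u ^+ 2 + enorm (Z w) ^+ 2).
    by rewrite ler_wpM2l//; lra.
  lra.
rewrite gaussED; last 2 first.
- by apply: lin_growth_integrable; exact: lin_growth_cst.
- exact: lin_growth_integrable.
rewrite gaussE_cst gaussE_dot_affine dotvDr -sqr_enorm_dot dotvZr.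
have d1 : - dotv u a <= L * brk u ^+ 2.
  have := dotv_le u a; rewrite ler_norml => /andP[+ _].
  have : enorm u * enorm a <= brk u * (L * brk u).
    by apply: ler_pM => //; exact: enorm_ge0.
  rewrite expr2; lra.
have := ler_wpM2l h0 d1; have := sqr_brk u; rewrite expr2.
lra.
Qed.

End affine_step.

(** * Regularity of the discrete-time value functions *)

Section maxreg.
Context {R : realType} {q : nat}.
Implicit Types (a : 'I_q -> R).

Lemma maxreg_ge i j a : a j <= maxreg i a.
Proof. by rewrite /maxreg (bigD1 j)//= le_max lexx. Qed.

Lemma maxreg_attained i a : exists j, maxreg i a = a j.
Proof.
apply: (big_ind (fun x => exists j, x = a j)) => [|x y [j ->] [k ->]|j _].
- by exists i.
- by case: (leP (a j) (a k)) => _; [exists k|exists j].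
- by exists j.
Qed.

Lemma maxreg_le i a M : (forall j, a j <= M) -> maxreg i a <= M.
Proof. by have [j ->] := maxreg_attained i a. Qed.

Lemma maxreg_dist i a a' M : (forall j, `|a j - a' j| <= M) ->
  `|maxreg i a - maxreg i a'| <= M.
Proof.
move=> h; rewrite ler_norml; apply/andP; split.
- have [j ->] := maxreg_attained i a'.
  have := maxreg_ge i j a; have := h j; rewrite ler_norml => /andP[]; lra.
- have [j ->] := maxreg_attained i a.
  have := maxreg_ge i j a'; have := h j; rewrite ler_norml => /andP[]; lra.
Qed.

End maxreg.

(** The arithmetic of one step of [switching_lyapunov]. Here [J] is the bracket of
    [x], [D] the distance of the two points, [s] is 1 at a switch and 0 otherwise,
    and the capital letters [EV], [EA], [ED], [A2], [D2], [S2] stand for the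
    moments after the step. The mean of [S] exceeds [S1 = S0 + c0 * s] up to a
    term [h * r]; the gain [c0 * s] of the mean becomes the gain
    [2 * c0 * s * tau] of the square, as [S0 >= tau]. *)
Lemma lyapunov_step {R : realFieldType}
    (L c0 h K Gam M lam be t s J D EV EV' EA ED A2 D2 S2 fx fy cx cy vx vy : R) :
  0 <= L -> 0 < c0 -> 0 <= h -> 0 <= Gam -> 0 <= t -> 1 <= J -> 0 <= D ->
  0 <= s -> s <= 1 -> M = L * (1 + Gam) + 2 * Gam + c0 + 1 ->
  2 * lam * c0 = L -> 0 <= lam -> L + 2 * lam * M ^+ 2 <= be ->
  (forall z, 2 * z * (EV + (Gam * EA + t * ED)) - z ^+ 2 <= S2) ->
  t * (EV - EV') <= be * (A2 + t ^+ 2 * D2) - lam * S2 ->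
  A2 <= (1 + K * h) * J ^+ 2 -> D2 <= (1 + K * h) * D ^+ 2 ->
  (1 - L * h) * J <= EA -> (1 - L * h) * D <= ED ->
  - (Gam * J) <= vx -> vx <= Gam * J ->
  vx = EV + h * fx - cx -> EV' + h * fy - cy <= vy ->
  fx <= L * J -> fx - fy <= L * D ->
  cy - cx <= L * s * D -> c0 * s <= cx ->
  t * (vx - vy) <=
  be * (1 + (K + 2) * h) * (J ^+ 2 + (t * D) ^+ 2) -
  lam * (vx + Gam * J + t * D) ^+ 2.
Proof.
move=> L0 c00 h0 Gam0 t0 J1 D0 s0 s1 ME lamE lam0 beM hS2 HI A2le D2le Age Dge.
move=> g1 g2 vxE vyE fxle fxy cxy cs.
have J0 : 0 <= J by exact: le_trans J1.
set tau := t * D; have tau0 : 0 <= tau by exact: mulr_ge0.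
set S0 := vx + Gam * J + tau; set S1 := S0 + c0 * s.
have S0tau : tau <= S0 by rewrite /S0; lra.
have cs0 : 0 <= c0 * s by rewrite mulr_ge0// ltW.
have S10 : 0 <= S1 by rewrite /S1; lra.
pose r := L * (1 + Gam) * J + L * tau.
pose rho := J ^+ 2 + tau ^+ 2.
have rho0 : 0 <= rho by rewrite addr_ge0 ?sqr_ge0.
have LG0 : 0 <= L * (1 + Gam) by rewrite mulr_ge0// addr_ge0.
have M0 : 0 <= M by rewrite ME; lra.
have ESge : S1 - h * r <= EV + (Gam * EA + t * ED).
  have e1 := ler_wpM2l h0 fxle; have e2 := ler_wpM2l Gam0 Age.
  have e3 := ler_wpM2l t0 Dge.
  have -> : S1 - h * r = (vx - h * (L * J) + c0 * s) +
      Gam * ((1 - L * h) * J) + t * ((1 - L * h) * D).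
    by rewrite /S1 /S0 /r /tau; ring.
  lra.
have S2ge : S1 ^+ 2 - 2 * h * (S1 * r) <= S2.
  have := hS2 S1; have := ler_wpM2l S10 ESge.
  rewrite expr2; lra.
have S1sq : S0 ^+ 2 + 2 * c0 * s * tau <= S1 ^+ 2.
  have -> : S1 ^+ 2 = S0 ^+ 2 + 2 * (c0 * s * S0) + (c0 * s) ^+ 2.
    by rewrite /S1; ring.
  have := ler_wpM2l cs0 S0tau; have := sqr_ge0 (c0 * s); lra.
have Srle : S1 * r <= 2 * M ^+ 2 * rho.
  have r0 : 0 <= r by rewrite addr_ge0// mulr_ge0.
  have rM : r <= M * (J + tau).
    have -> : M * (J + tau) =
        r + L * Gam * tau + (2 * Gam + c0 + 1) * (J + tau).
      by rewrite ME /r; ring.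
    have : 0 <= L * Gam * tau by rewrite !mulr_ge0.
    have : 0 <= (2 * Gam + c0 + 1) * (J + tau) by rewrite mulr_ge0; lra.
    lra.
  have SM : S1 <= M * (J + tau).
    have -> : M * (J + tau) = 2 * Gam * J + tau + c0 * J +
        (L * (1 + Gam) * (J + tau) + 2 * Gam * tau + c0 * tau + J).
      by rewrite ME; ring.
    have p1 : c0 * s <= c0 * J by rewrite ler_wpM2l ?(ltW c00)//; lra.
    have : 0 <= L * (1 + Gam) * (J + tau) by rewrite mulr_ge0// addr_ge0.
    have : 0 <= Gam * tau by rewrite mulr_ge0.
    have : 0 <= c0 * tau by rewrite mulr_ge0// ltW.
    rewrite /S1 /S0; lra.
  apply: (le_trans (ler_pM S10 r0 SM rM)).
  have -> : M * (J + tau) * (M * (J + tau)) = M ^+ 2 * (J + tau) ^+ 2 by ring.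
  have -> : 2 * M ^+ 2 * rho = M ^+ 2 * (2 * rho) by ring.
  rewrite ler_wpM2l ?sqr_ge0// /rho.
  by have := sqr_ge0 (J - tau); rewrite sqrrB sqrrD; lra.
have taule : tau <= rho.
  have : 1 <= J ^+ 2 by rewrite exprn_ege1.
  by rewrite /rho; have := sqr_ge0 (tau - 1); have := sqr_ge0 tau;
    rewrite sqrrB1; lra.
have be0 : 0 <= be.
  by rewrite (le_trans _ beM)// addr_ge0// mulr_ge0 ?sqr_ge0// mulr_ge0.
have vle : t * (vx - vy) <= t * (EV - EV') + h * L * tau + L * s * tau.
  have -> : t * (EV - EV') + h * L * tau + L * s * tau =
      t * (EV - EV' + h * (L * D) + L * s * D) by rewrite /tau; ring.
  by rewrite ler_wpM2l//; have := ler_wpM2l h0 fxy; lra.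
have Rle : be * (A2 + t ^+ 2 * D2) <= be * ((1 + K * h) * rho).
  rewrite ler_wpM2l//; have := ler_wpM2l (sqr_ge0 t) D2le.
  rewrite /rho /tau exprMn; lra.
have Lle := ler_wpM2l (mulr_ge0 h0 L0) taule.
have Ble := ler_wpM2r (mulr_ge0 h0 rho0) beM.
have hSrle := ler_wpM2l (mulr_ge0 (ler0n _ 2) h0) Srle.
have S2le := ler_wpM2l lam0 (le_trans (lerB S1sq hSrle) S2ge).
have Lsl : 2 * lam * c0 * s * tau = L * s * tau by rewrite lamE.
have -> : be * (1 + (K + 2) * h) * rho =
  be * ((1 + K * h) * rho) + 2 * (be * (h * rho)) by ring.
have : 0 <= L * (h * rho) by rewrite !mulr_ge0.
lra.
Qed.

Section regularity.
Context {R : realType} {d q : nat}.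
Variables (b : 'cV[R]_d -> 'cV[R]_d) (sigma : 'cV[R]_d -> 'M[R]_d).
Variables (f g : 'I_q -> 'cV[R]_d -> R) (c : 'I_q -> 'I_q -> 'cV[R]_d -> R).
Variables (L c0 h : R).
Hypotheses (L0 : 0 <= L) (c00 : 0 < c0) (h0 : 0 <= h) (h1 : h <= 1).
Hypotheses (b_lip : forall x y, enorm (b x - b y) <= L * enorm (x - y))
  (b_growth : forall x, enorm (b x) <= L * jap x)
  (s_lip : forall x y, enorm (sigma x - sigma y) <= L * enorm (x - y))
  (s_growth : forall x, enorm (sigma x) <= L * jap x)
  (f_lip : forall i x y, `|f i x - f i y| <= L * enorm (x - y))
  (f_growth : forall i x, `|f i x| <= L * jap x)
  (g_lip : forall i x y, `|g i x - g i y| <= L * enorm (x - y))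
  (g_growth : forall i x, `|g i x| <= L * jap x)
  (c_lip : forall i j x y, `|c i j x - c i j y| <= L * enorm (x - y))
  (c_diag : forall i x, c i i x = 0)
  (c_offdiag : forall i j x, j != i -> c0 <= c i j x).

Local Notation E phi := (\int[@std_gaussian R d]_w phi w).
Local Notation F := (euler_step b sigma h).
Local Notation Kd := (moment_rate (d:=d) L).
Implicit Types (x y w : 'cV[R]_d) (i j : 'I_q) (n m : nat).

Let Kd0 : 0 <= Kd. Proof. exact: moment_rate_ge0. Qed.

Lemma euler_stepB x y w :
  F x w - F y w = (x - y) + h *: (b x - b y) +
    Num.sqrt h *: ((sigma x - sigma y) *m w).
Proof.
rewrite /euler_step mulmxBl !scalerBr; apply/matrixP => i j.
by rewrite !mxE; ring.
Qed.

Lemma lin_growth_step phi x : lin_growth phi -> lin_growth (fun w => phi (F x w)).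
Proof. by move=> hphi; exact: lin_growth_affine. Qed.

Lemma lin_growth_step_dist x y : lin_growth (fun w => enorm (F x w - F y w)).
Proof.
under eq_fun do rewrite euler_stepB.
exact: (lin_growth_affine (x - y) (b x - b y) (sigma x - sigma y) h
  lin_growth_enorm).
Qed.

Lemma lin_growth_jap : lin_growth (@jap R d).
Proof. by apply: lin_growth_brk. Qed.

Lemma gaussE_sqr_jap x :
  E (fun w => jap (F x w) ^+ 2) <= (1 + Kd * h) * jap x ^+ 2.
Proof. by apply: gaussE_sqr_brk_le. Qed.

Lemma gaussE_jap_le x : E (fun w => jap (F x w)) <= (1 + Kd * h) * jap x.
Proof. by apply: gaussE_brk_le. Qed.

Lemma gaussE_jap_ge x : (1 - L * h) * jap x <= E (fun w => jap (F x w)).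
Proof. by apply: gaussE_brk_ge. Qed.

Let enorm_brk0 (z : 'cV[R]_d) : enorm z = Num.sqrt (0 + enorm z ^+ 2).
Proof. by rewrite add0r sqrtr_sqr ger0_norm// enorm_ge0. Qed.

Lemma gaussE_sqr_dist x y :
  E (fun w => enorm (F x w - F y w) ^+ 2) <= (1 + Kd * h) * enorm (x - y) ^+ 2.
Proof.
under eq_Rintegral do rewrite euler_stepB enorm_brk0.
rewrite [X in _ * X ^+ 2]enorm_brk0.
by apply: gaussE_sqr_brk_le; rewrite -?enorm_brk0.
Qed.

Lemma gaussE_dist_le x y :
  E (fun w => enorm (F x w - F y w)) <= (1 + Kd * h) * enorm (x - y).
Proof.
under eq_Rintegral do rewrite euler_stepB enorm_brk0.
rewrite [X in _ * X]enorm_brk0.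
by apply: gaussE_brk_le; rewrite -?enorm_brk0.
Qed.

Lemma gaussE_dist_ge x y :
  (1 - L * h) * enorm (x - y) <= E (fun w => enorm (F x w - F y w)).
Proof.
under eq_Rintegral do rewrite euler_stepB enorm_brk0.
rewrite [X in _ * X <= _]enorm_brk0.
by apply: gaussE_brk_ge; rewrite -?enorm_brk0.
Qed.

Local Notation v := (fun m n i =>
  backward f g c (fun=> trans_kernel b sigma h) h m n i).

(** The constant deteriorates with [n]: this bound only serves measurability and
    integrability. *)
Lemma value_lipschitz m n : exists Ln, 0 <= Ln /\
  forall i x y, `|v m n i x - v m n i y| <= Ln * enorm (x - y).
Proof.
elim: n => [|n [Ln [Ln0 IHn]]]; first by exists L; split => //= i x y.
exists (Ln * (1 + Kd * h) + h * L + L); split.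
  have K1 : 0 <= 1 + Kd * h by rewrite addr_ge0// mulr_ge0.
  by rewrite !addr_ge0// mulr_ge0.
move=> i x y /=; apply: maxreg_dist => j; rewrite /trans_kernel.
set phi := backward f g c _ h m n j.
have lg : lin_growth phi.
  by apply: lipschitz_lin_growth; exists Ln => ? ?; exact: IHn.
have lx := lin_growth_integrable (lin_growth_step x lg).
have ly := lin_growth_integrable (lin_growth_step y lg).
have ld := lin_growth_step_dist x y.
have PB : `|E (fun w => phi (F x w)) - E (fun w => phi (F y w))| <=
    Ln * (1 + Kd * h) * enorm (x - y).
  rewrite -RintegralB//; apply: le_trans (le_normr_Rintegral _ _) _ => //.
    exact: (integrableB measurableT lx ly).
  apply: (@le_trans _ _ (E (fun w => Ln * enorm (F x w - F y w)))).
    apply: gaussE_le => [||w]; last exact: IHn.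
    - have := lin_growth_integrable (lin_growthB (lin_growth_step x lg)
        (lin_growth_step y lg)).
      exact: integrable_norm.
    - by apply: lin_growth_integrable; exact: lin_growthZ.
  rewrite gaussEZ; last exact: lin_growth_integrable.
  by rewrite -mulrA ler_wpM2l// gaussE_dist_le.
have := f_lip j x y; have := c_lip i j x y; move: PB.
rewrite !ler_norml; 
move: (E (fun w => phi (F x w))) (E (fun w => phi (F y w))) => e1 e2.
move=> /andP[p1 p2] /andP[p3 p4] /andP[p5 p6].
have := ler_wpM2l h0 p5; have := ler_wpM2l h0 p6.
by move=> p7 p8; apply/andP; split; lra.
Qed.

Lemma lin_growth_value m n i : lin_growth (v m n i).
Proof.
have [Ln [_ hL]] := value_lipschitz m n.
by apply: lipschitz_lin_growth; exists Ln => x y; exact: hL.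
Qed.

(** The upper bound drops the nonnegative switching costs, and the lower bound is
    the value of the strategy that never switches. *)
Lemma value_growth m n i x :
  `|v m n i x| <= L * (1 + (Kd + 1) * h) ^+ n * jap x.
Proof.
elim: n i x => [|n IHn] i x /=; first by rewrite expr0 mulr1.
set G := L * (1 + (Kd + 1) * h) ^+ n.
have G0 : L <= G.
  rewrite ler_peMr// exprn_ege1// lerDl mulr_ge0// addr_ge0//.
have PE j : `|E (fun w => v m n j (F x w))| <= G * ((1 + Kd * h) * jap x).
  have lg := lin_growth_step x (lin_growth_value m n j).
  apply: le_trans (le_normr_Rintegral _ _) _ => //.
    exact: lin_growth_integrable.
  apply: (@le_trans _ _ (E (fun w => G * jap (F x w)))).
    apply: gaussE_le => [||w]; last exact: IHn.
    - exact: (integrable_norm (lin_growth_integrable lg)).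
    - apply: lin_growth_integrable; apply: lin_growthZ.
      exact: lin_growth_step lin_growth_jap.
  rewrite gaussEZ; last first.
    by apply: lin_growth_integrable; exact: lin_growth_step lin_growth_jap.
  by rewrite ler_wpM2l ?(le_trans L0 G0)// gaussE_jap_le.
have j0 := jap_ge0 x.
have -> : L * (1 + (Kd + 1) * h) ^+ n.+1 * jap x =
   G * ((1 + Kd * h) * jap x) + h * (G * jap x) by rewrite exprS /G; ring.
have fG j : `|h * f j x| <= h * (G * jap x).
  rewrite normrM (ger0_norm h0) ler_wpM2l// (le_trans (f_growth j x))//.
  exact: ler_wpM2r.
have c_ge0 j : 0 <= c i j x.
  have [->|ji] := eqVneq j i; first by rewrite c_diag.
  by rewrite (le_trans (ltW c00))// c_offdiag.
rewrite ler_norml; apply/andP; split.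
- apply: le_trans (maxreg_ge i i _); rewrite c_diag.
  have := fG i; have := PE i; rewrite !ler_norml => /andP[p1 _] /andP[p2 _].
  move: p1 p2; rewrite /trans_kernel; lra.
- apply: maxreg_le => j; have := c_ge0 j.
  have := fG j; have := PE j; rewrite !ler_norml => /andP[_ p1] /andP[_ p2].
  move: p1 p2; rewrite /trans_kernel; lra.
Qed.

(* [N] bounds the number of dates; [Gam] and, below, [B] bound the growing constants
   of the inductions up to [N]. *)
Variables (Gam : R) (N : nat).
Hypothesis (Gam_ge : forall n, (n <= N)%N -> L * (1 + (Kd + 1) * h) ^+ n <= Gam).

Let Gam0 : 0 <= Gam.
Proof.
by rewrite (le_trans L0)//; have := Gam_ge (leq0n N); rewrite expr0 mulr1.
Qed.

Lemma value_growth_unif m n i x : (n <= N)%N -> `|v m n i x| <= Gam * jap x.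
Proof.
move=> nN; rewrite (le_trans (value_growth m n i x))// ler_wpM2r ?jap_ge0//.
exact: Gam_ge.
Qed.

Let M := L * (1 + Gam) + 2 * Gam + c0 + 1.
Let lam := L / (2 * c0).
Let beta0 := L + 2 * lam * M ^+ 2.
Let beta n := beta0 * (1 + (Kd + 2) * h) ^+ n.

Let lam0 : 0 <= lam. Proof. by rewrite divr_ge0// mulr_ge0// ltW. Qed.

Let M0 : 0 <= M.
Proof. by rewrite /M !addr_ge0 ?mulr_ge0 ?addr_ge0// ltW. Qed.

Let beta_ge n : beta0 <= beta n.
Proof.
have b0 : 0 <= beta0 by rewrite addr_ge0// mulr_ge0 ?sqr_ge0// mulr_ge0.
by rewrite ler_peMr// exprn_ege1// lerDl mulr_ge0// addr_ge0.
Qed.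

(** The regime optimal at [x] is used at both points. A switch costs at most
    [L * t * enorm (x - y)] in the difference of the values and is paid for by the
    negative square: switching raises the mean of the squared expression, since
    the continuation value exceeds the current value by the switching cost. *)
Lemma switching_lyapunov m n i x y t : (n <= N)%N -> 0 <= t ->
  t * (v m n i x - v m n i y) <=
  beta n * (jap x ^+ 2 + (t * enorm (x - y)) ^+ 2) -
  lam * (v m n i x + Gam * jap x + t * enorm (x - y)) ^+ 2.
Proof.
move=> + t0; elim: n i x y => [|n IHn] i x y nN.
  have gr := value_growth_unif m i x nN.
  move: gr; rewrite /= ler_norml => /andP[g1 g2].
  have J0 := jap_ge1 x; have D0 := enorm_ge0 (x - y).
  have := g_lip i x y; rewrite ler_norml => /andP[_ glip].
  rewrite /beta expr0 mulr1 /beta0.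
  have := ler_wpM2l t0 glip.
  set tau := t * enorm (x - y).
  have tau0 : 0 <= tau by exact: mulr_ge0.
  have -> : t * (L * enorm (x - y)) = L * tau by rewrite mulrCA.
  set J := jap x in J0 g1 g2 *.
  have S0 : 0 <= g i x + Gam * J + tau by lra.
  have SM : g i x + Gam * J + tau <= M * (J + tau).
    have : 0 <= M * (J + tau) - (2 * Gam * J + tau); last lra.
    have -> : M * (J + tau) - (2 * Gam * J + tau) =
       (L * (1 + Gam) + c0) * (J + tau) + J + 2 * Gam * tau.
      by rewrite /M; ring.
    have J00 : 0 <= J by lra.
    have : 0 <= L * (1 + Gam) + c0 by rewrite addr_ge0 ?mulr_ge0 ?addr_ge0// ltW.
    move=> k0; have := mulr_ge0 k0 (addr_ge0 J00 tau0).
    have := mulr_ge0 Gam0 tau0; lra.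
  have S2 : (g i x + Gam * J + tau) ^+ 2 <= M ^+ 2 * (2 * (J ^+ 2 + tau ^+ 2)).
    apply: (@le_trans _ _ ((M * (J + tau)) ^+ 2)).
      by rewrite lerXn2r ?nnegrE// (le_trans S0).
    rewrite exprMn ler_wpM2l ?sqr_ge0//.
    by have := sqr_ge0 (J - tau); rewrite sqrrB sqrrD; lra.
  have tJ : tau <= J ^+ 2 + tau ^+ 2.
    have : 1 <= J ^+ 2 by rewrite exprn_ege1.
    by have := sqr_ge0 (tau - 1); have := sqr_ge0 tau; rewrite sqrrB1; lra.
  have := ler_wpM2l lam0 S2; have := ler_wpM2l L0 tJ.
  lra.
rewrite /=.
set a := fun j => _; have [j aj] := maxreg_attained i a.
have ay : trans_kernel b sigma h (v m n j) y + h * f j y - c i j y <=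
    maxreg i (fun j => trans_kernel b sigma h (v m n j) y + h * f j y - c i j y).
  exact: (maxreg_ge i j (fun j => trans_kernel b sigma h (v m n j) y +
    h * f j y - c i j y)).
have {IHn}IH := IHn j _ _ (ltnW nN).
have grx := value_growth_unif m i x nN.
move: grx; rewrite /= -/a aj ler_norml => /andP[g1 g2].
move: ay; set vy := maxreg i _ => ay.
clear aj; rewrite {}/a in g1 g2 *.
set vx := trans_kernel b sigma h (v m n j) x + h * f j x - c i j x in g1 g2 *.
pose V w := v m n j (F x w); pose V' w := v m n j (F y w).
pose A w := jap (F x w); pose D w := enorm (F x w - F y w).
have lV : lin_growth V by apply: lin_growth_step; exact: lin_growth_value.
have lV' : lin_growth V' by apply: lin_growth_step; exact: lin_growth_value.
have lA : lin_growth A by apply: lin_growth_step; exact: lin_growth_jap.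
have lD : lin_growth D by exact: lin_growth_step_dist.
pose S w := V w + (Gam * A w + t * D w).
have lGA := lin_growthZ Gam lA; have ltD := lin_growthZ t lD.
have lGAtD := lin_growthD lGA ltD.
have lS : lin_growth S := lin_growthD lV lGAtD.
have HI : t * (E V - E V') <= beta n * (E (fun w => A w ^+ 2) +
    t ^+ 2 * E (fun w => D w ^+ 2)) - lam * E (fun w => S w ^+ 2).
  have iA2 := lin_growth_integrable_sqr lA.
  have iD2 := lin_growth_integrable_sqr lD.
  have iS2 := lin_growth_integrable_sqr lS.
  have itD2 := integrableZl measurableT (t ^+ 2) iD2.
  have ir : (std_gaussian d).-integrable setT
      (EFin \o (fun w => A w ^+ 2 + t ^+ 2 * D w ^+ 2)).
    exact: (integrableD measurableT iA2 itD2).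
  have ibr := integrableZl measurableT (beta n) ir.
  have ils := integrableZl measurableT (- lam) iS2.
  have -> : t * (E V - E V') = E (fun w => t * (V w - V' w)).
    rewrite gaussEZ ?RintegralB//; try exact: lin_growth_integrable.
    by apply: lin_growth_integrable; exact: lin_growthB.
  have -> : beta n * (E (fun w => A w ^+ 2) + t ^+ 2 * E (fun w => D w ^+ 2)) -
      lam * E (fun w => S w ^+ 2) =
      E (fun w => beta n * (A w ^+ 2 + t ^+ 2 * D w ^+ 2) +
        (- lam) * S w ^+ 2).
    by rewrite gaussED// !gaussEZ// gaussED// gaussEZ// mulNr.
  apply: gaussE_le => [||w].
  - by apply: lin_growth_integrable; apply: lin_growthZ; exact: lin_growthB.
  - exact: (integrableD measurableT ibr ils).
  - have := IH (F x w) (F y w); rewrite -/(V w) -/(V' w) -/(A w) -/(D w).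
    by rewrite exprMn /S addrA mulNr.
have ES : E S = E V + (Gam * E A + t * E D).
  rewrite gaussED; [|exact: lin_growth_integrable..].
  rewrite gaussED; [|exact: lin_growth_integrable..].
  by rewrite !gaussEZ//; exact: lin_growth_integrable.
have ES2 z : 2 * z * E S - z ^+ 2 <= E (fun w => S w ^+ 2).
  have : 0 <= E (fun w => S w ^+ 2 + (- (2 * z) * S w + z ^+ 2)).
    apply: Rintegral_ge0 => w _.
    by rewrite (_ : _ + _ = (S w - z) ^+ 2) ?sqr_ge0//; ring.
  have lc := lin_growth_cst (d:=d) (z ^+ 2).
  have lZ := lin_growthZ (- (2 * z)) lS.
  rewrite gaussED; last 2 first.
  - exact: lin_growth_integrable_sqr.
  - by apply: lin_growth_integrable; exact: lin_growthD.
  rewrite gaussED; [|exact: lin_growth_integrable..].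
  rewrite gaussEZ ?gaussE_cst; last exact: lin_growth_integrable.
  lra.
have A2le := gaussE_sqr_jap x; have D2le := gaussE_sqr_dist x y.
have Age := gaussE_jap_ge x; have Dge := gaussE_dist_ge x y.
rewrite -/(E (fun w => A w ^+ 2)) in A2le; rewrite -/(E A) in Age.
rewrite -/(E (fun w => D w ^+ 2)) in D2le; rewrite -/(E D) in Dge.
have vxE : vx = E V + h * f j x - c i j x by [].
have vyE : E V' + h * f j y - c i j y <= vy by exact: ay.
have cxy : c i j y - c i j x <= L * (j != i)%:R * enorm (x - y).
  have [->|ji] := eqVneq j i; first by rewrite !c_diag subrr mulr0 mul0r.
  by rewrite mulr1; have := c_lip i j x y; rewrite ler_norml => /andP[]; lra.
have cs : c0 * (j != i)%:R <= c i j x.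
  have [->|ji] := eqVneq j i; first by rewrite c_diag mulr0.
  by rewrite mulr1 c_offdiag.
rewrite /beta exprSr mulrA -/(beta n).
rewrite ES in ES2.
apply: (lyapunov_step (M := M) (s := (j != i)%:R) (fx := f j x) (fy := f j y)
  L0 c00 h0 Gam0 t0 _ _ _ _ _ _ _ _ ES2 HI A2le D2le Age Dge g1 g2 vxE vyE
  _ _ cxy cs) => //.
- exact: jap_ge1.
- exact: enorm_ge0.
- by case: (j != i).
- by rewrite /lam; field; rewrite gt_eqF.
- exact: le_trans (ler_norm _) (f_growth _ _).
- exact: le_trans (ler_norm _) (f_lip _ _ _).
Qed.

Variable B : R.
Hypothesis (B_ge : forall n, (n <= N)%N -> beta n <= B).

Let B0 : 0 <= B.
Proof.
rewrite (le_trans _ (B_ge (leq0n N)))// (le_trans _ (beta_ge 0))//.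
by rewrite addr_ge0// mulr_ge0 ?sqr_ge0// mulr_ge0.
Qed.

Let value_diff_le m n i x y : (n <= N)%N ->
  v m n i x - v m n i y <= B * 2 * jap x * enorm (x - y).
Proof.
move=> nN; have [xy0|xyn0] := eqVneq (enorm (x - y)) 0.
  have /subr0_eq -> := enorm_eq0 xy0.
  by rewrite !subrr enorm0 mulr0.
have D0 : 0 < enorm (x - y) by rewrite lt_def xyn0 enorm_ge0.
have J0 : 0 < jap x by rewrite (lt_le_trans ltr01)// jap_ge1.
(* This [t] balances the two terms of [jap x ^+ 2 + (t * enorm (x - y)) ^+ 2]. *)
pose t := jap x / enorm (x - y).
have t0 : 0 < t by rewrite divr_gt0.
have := switching_lyapunov m i x y nN (ltW t0).
have -> : t * enorm (x - y) = jap x by rewrite divfK.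
set z := v m n i x + _ + _ => h2.
have h3 : t * (v m n i x - v m n i y) <= B * (jap x ^+ 2 + jap x ^+ 2).
  apply: (le_trans h2); have := mulr_ge0 lam0 (sqr_ge0 z).
  have : beta n * (jap x ^+ 2 + jap x ^+ 2) <= B * (jap x ^+ 2 + jap x ^+ 2).
    by rewrite ler_wpM2r ?addr_ge0 ?sqr_ge0// B_ge.
  lra.
rewrite -(ler_pM2l t0) (le_trans h3)//.
have -> : t * (B * 2 * jap x * enorm (x - y)) =
   B * 2 * jap x * (t * enorm (x - y)) by ring.
by rewrite divfK// expr2; lra.
Qed.

(** [value_diff_le] carries the bracket of the point whose regimes are followed.
    The brackets of close points are comparable, and linear growth suffices for
    distant points, so that the bracket of [y] does in both directions. *)
Lemma value_loc_lipschitz m n i x y : (n <= N)%N ->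
  `|v m n i x - v m n i y| <= (4 * B + 3 * Gam) * (jap y * enorm (x - y)).
Proof.
move=> nN.
have J1 := jap_ge1 y; have D0 := enorm_ge0 (x - y).
have JD0 : 0 <= jap y * enorm (x - y) by rewrite mulr_ge0// jap_ge0.
have GJ := mulr_ge0 Gam0 JD0; have BJ := mulr_ge0 B0 JD0.
have jt := jap_triangle x y.
have d1 := value_diff_le m i x y nN; have d2 := value_diff_le m i y x nN.
rewrite (enormBC y x) in d2.
rewrite ler_norml; apply/andP; split; first by lra.
have [Dle1|D1] := leP (enorm (x - y)) 1.
  have : B * 2 * jap x * enorm (x - y) <= B * 2 * (2 * jap y) * enorm (x - y).
    by rewrite ler_wpM2r// ler_wpM2l ?mulr_ge0//; lra.
  lra.
have gx := value_growth_unif m i x nN; have gy := value_growth_unif m i y nN.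
move: gx gy; rewrite !ler_norml => /andP[_ gx] /andP[gy _].
have JD : jap y <= jap y * enorm (x - y) by rewrite ler_peMr ?jap_ge0// ltW.
have DJ : enorm (x - y) <= jap y * enorm (x - y) by rewrite ler_peMl.
have : Gam * (jap x + jap y) <= Gam * (3 * (jap y * enorm (x - y))).
  by rewrite ler_wpM2l//; lra.
lra.
Qed.

(** The quantized recursion replaces the kernel and not the value function, so
    that the modulus is needed for the continuation values. The mean of the
    product of bracket and distance is split by a weighted inequality between
    arithmetic and geometric means. *)
Lemma kernel_loc_lipschitz m n i x y : (n <= N)%N ->
  `|trans_kernel b sigma h (v m n i) x - trans_kernel b sigma h (v m n i) y| <=
  (4 * B + 3 * Gam) * (1 + Kd) * (jap y * enorm (x - y)).
Proof.
move=> nN; have [xy0|xyn0] := eqVneq (enorm (x - y)) 0.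
  have /subr0_eq -> := enorm_eq0 xy0.
  by rewrite !subrr enorm0 normr0 !mulr0.
have D0 : 0 < enorm (x - y) by rewrite lt_def xyn0 enorm_ge0.
have J0 : 0 < jap y by rewrite (lt_le_trans ltr01)// jap_ge1.
pose eta := enorm (x - y) / jap y.
have e0 : 0 < eta by rewrite divr_gt0.
set C := 4 * B + 3 * Gam.
have C0 : 0 <= C by rewrite addr_ge0 ?mulr_ge0.
have lx := lin_growth_step x (lin_growth_value m n i).
have ly := lin_growth_step y (lin_growth_value m n i).
have lD := lin_growth_step_dist x y.
have lJ := lin_growth_step y lin_growth_jap.
have iJ := integrableZl measurableT (eta / 2) (lin_growth_integrable_sqr lJ).
have iD := integrableZl measurableT (2 * eta)^-1 (lin_growth_integrable_sqr lD).
rewrite /trans_kernel -RintegralB//; [|exact: lin_growth_integrable..].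
have iB := lin_growth_integrable (lin_growthB lx ly).
apply: (le_trans (le_normr_Rintegral measurableT iB)).
have isum : (std_gaussian d).-integrable setT (EFin \o (fun w =>
    eta / 2 * jap (F y w) ^+ 2 + (2 * eta)^-1 * enorm (F x w - F y w) ^+ 2)).
  exact: (integrableD measurableT iJ iD).
apply: (@le_trans _ _ (E (fun w => C * (eta / 2 * jap (F y w) ^+ 2 +
    (2 * eta)^-1 * enorm (F x w - F y w) ^+ 2)))).
  apply: gaussE_le => [||w].
  - exact: (integrable_norm iB).
  - exact: (integrableZl measurableT C isum).
  - apply: (le_trans (value_loc_lipschitz m i (F x w) (F y w) nN)).
    rewrite ler_wpM2l//.
    set a := jap _; set z := enorm _.
    have -> : eta / 2 * a ^+ 2 + (2 * eta)^-1 * z ^+ 2 =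
        a * z + (2 * eta)^-1 * (eta * a - z) ^+ 2.
      by field; rewrite gt_eqF.
    by rewrite lerDl mulr_ge0 ?sqr_ge0// invr_ge0 mulr_ge0// ltW.
rewrite gaussEZ// gaussED//.
rewrite !gaussEZ; [|exact: lin_growth_integrable_sqr..].
rewrite -[X in _ <= X]mulrA ler_wpM2l//.
have h3 := gaussE_sqr_jap y; have h4 := gaussE_sqr_dist x y.
have e1 : 0 <= eta / 2 by rewrite mulr_ge0// ltW.
have e2 : 0 <= (2 * eta)^-1 by rewrite invr_ge0 mulr_ge0// ltW.
apply: (le_trans (lerD (ler_wpM2l e1 h3) (ler_wpM2l e2 h4))).
have -> : eta / 2 * ((1 + Kd * h) * jap y ^+ 2) +
   (2 * eta)^-1 * ((1 + Kd * h) * enorm (x - y) ^+ 2) =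
   (1 + Kd * h) * (jap y * enorm (x - y)).
  by rewrite /eta; field; rewrite !gt_eqF.
rewrite ler_wpM2r ?mulr_ge0 ?jap_ge0 ?enorm_ge0// lerD2l ler_piMr//.
Qed.

End regularity.

Section uniform_regularity.
Context {R : realType} {d q : nat}.
Variables (b : 'cV[R]_d -> 'cV[R]_d) (sigma : 'cV[R]_d -> 'M[R]_d).
Variables (f g : 'I_q -> 'cV[R]_d -> R) (c : 'I_q -> 'I_q -> 'cV[R]_d -> R).

Let growth_of_lip (phi : 'cV[R]_d -> R) : lipschitz_fun phi ->
  exists2 C, 0 <= C & forall x, `|phi x| <= C * jap x.
Proof.
move=> /lipschitz_lin_growth[_ [C hC]].
have C0 : 0 <= C.
  have := le_trans (normr_ge0 _) (hC 0).
  by rewrite enorm0 addr0 mulr1.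
exists (C * 2) => [|x]; first by rewrite mulr_ge0.
rewrite (le_trans (hC x))// -mulrA ler_wpM2l//.
by have := jap_ge1 x; have := enorm_le_jap x; lra.
Qed.

Let growth_of_lip_mx m n (phi : 'cV[R]_d -> 'M[R]_(m, n)) : lipschitz_mx phi ->
  exists2 C, 0 <= C & forall x, enorm (phi x) <= C * jap x.
Proof.
move=> [L hL].
have /choice[C hC] : forall ij : 'I_m * 'I_n, exists C,
    0 <= C /\ forall x, `|phi x ij.1 ij.2| <= C * jap x.
  move=> [i j] /=; have [|C C0 hC] := @growth_of_lip (fun x => phi x i j).
    exists L => x y; apply: le_trans (hL x y).
    by have := normr_coord_le_enorm (phi x - phi y) i j; rewrite !mxE.
  by exists C.
pose C2 := \sum_i \sum_j C (i, j) ^+ 2.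
have C20 : 0 <= C2.
  by apply: sumr_ge0 => i _; apply: sumr_ge0 => j _; exact: sqr_ge0.
exists (Num.sqrt C2) => [|x]; first exact: sqrtr_ge0.
rewrite -(@ler_pXn2r _ 2)// ?nnegrE ?mulr_ge0 ?sqrtr_ge0 ?enorm_ge0//.
rewrite exprMn (sqr_sqrtr C20) sqr_enorm mulr_suml; apply: ler_sum => i _.
rewrite mulr_suml; apply: ler_sum => j _.
rewrite -exprMn -[X in X <= _](real_normK (num_real _)).
have [Cij0 hij] := hC (i, j).
by rewrite lerXn2r ?nnegrE ?mulr_ge0 ?jap_ge0//; exact: hij.
Qed.

Let common_lower_bound (I : finType) (P : pred I) (a : I -> 'cV[R]_d -> R) :
  (forall i, P i -> (0 < ereal_inf (range (EFin \o a i)))%E) ->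
  exists2 e, 0 < e & forall i x, P i -> e <= a i x.
Proof.
move=> ha.
have /choice[e he] : forall i, exists e, 0 < e /\ forall x, P i -> e <= a i x.
  move=> i; have [Pi|_] := boolP (P i); last by exists 1.
  have := ha i Pi; set I0 := ereal_inf _ => I0gt.
  have lb x : (I0 <= (a i x)%:E)%E by apply: ereal_inf_lbound; exists x.
  have I0fin : I0 \is a fin_num.
    by rewrite fin_numElt (lt_trans _ I0gt) ?ltNyr//= (le_lt_trans (lb 0))// ltry.
  exists (fine I0); split; first by rewrite fine_gt0// I0gt ltey_eq I0fin.
  by move=> x _; rewrite -lee_fin fineK.
exists (\big[Num.min/1]_i e i).
  apply: (big_ind (fun x => 0 < x)) => // [x y x0 y0|i _].
    by rewrite lt_min x0.
  exact: (he i).1.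
move=> i x Pi; rewrite (le_trans _ ((he i).2 x Pi))// (bigD1 i)//=.
by rewrite ge_min lexx.
Qed.

Let common_constant (I : finType) (P : I -> R -> Prop) :
  (forall i, exists C, P i C) -> (forall i C C', C <= C' -> P i C -> P i C') ->
  exists2 C, 0 <= C & forall i, P i C.
Proof.
move=> /choice[C hC] mono; exists (\sum_i `|C i|); first exact: sumr_ge0.
move=> i; apply: mono (hC i); rewrite (bigD1 i)//= (le_trans (ler_norm _))//.
by rewrite lerDl; exact: sumr_ge0.
Qed.

(** The constants of the inductions are multiplied by [1 + a * h] at each of the
    [n] steps, hence by at most [exp (a * T)] altogether. *)
Lemma value_uniform_regularity (T : R) : switching_assumptions b sigma f g c ->
  exists2 C, 0 <= C &
    [/\ forall j x y, `|f j x - f j y| <= C * enorm (x - y),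
        forall i j x y, `|c i j x - c i j y| <= C * enorm (x - y),
        forall h m n i, 0 <= h -> h <= 1 ->
          lin_growth (backward f g c (fun=> trans_kernel b sigma h) h m n i) &
        forall h m n i x y, 0 <= h -> h <= 1 -> h * n%:R <= T ->
          let v := backward f g c (fun=> trans_kernel b sigma h) h m n i in
          let Pv := trans_kernel b sigma h v in
          `|v x - v y| <= C * (jap y * enorm (x - y)) /\
          `|Pv x - Pv y| <= C * (jap y * enorm (x - y))].
Proof.
move=> [[blip slip] [flip glip clip] [cdiag coff _] _].
have weaken (C C' D a : R) : 0 <= D -> C <= C' -> a <= C * D -> a <= C' * D.
  by move=> D0 CC' /le_trans; apply; exact: ler_wpM2r.
have [C1 C10 hC1] : exists2 C, 0 <= C &
    forall _ : unit, [/\ forall x y, enorm (b x - b y) <= C * enorm (x - y),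
      forall x y, enorm (sigma x - sigma y) <= C * enorm (x - y),
      forall x, enorm (b x) <= C * jap x &
      forall x, enorm (sigma x) <= C * jap x].
  have [Cb hb] := blip; have [Cs hs] := slip.
  have [Cb' _ hb'] := growth_of_lip_mx blip.
  have [Cs' _ hs'] := growth_of_lip_mx slip.
  exists (`|Cb| + `|Cs| + `|Cb'| + `|Cs'|); first by rewrite !addr_ge0.
  have := ler_norm Cb; have := ler_norm Cs; have := ler_norm Cb'.
  have := ler_norm Cs'; have := normr_ge0 Cb; have := normr_ge0 Cs.
  have := normr_ge0 Cb'; have := normr_ge0 Cs' => *.
  split=> *.
  - by apply: weaken (hb _ _); [exact: enorm_ge0|lra].
  - by apply: weaken (hs _ _); [exact: enorm_ge0|lra].
  - by apply: weaken (hb' _); [exact: jap_ge0|lra].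
  - by apply: weaken (hs' _); [exact: jap_ge0|lra].
have [C2 C20 hC2] : exists2 C, 0 <= C &
    forall i, [/\ forall x y, `|f i x - f i y| <= C * enorm (x - y),
      forall x y, `|g i x - g i y| <= C * enorm (x - y),
      forall x, `|f i x| <= C * jap x & forall x, `|g i x| <= C * jap x].
  apply: common_constant => [i|i C C' CC' [h1 h2 h3 h4]]; last first.
    split=> *; [apply: weaken (h1 _ _)|apply: weaken (h2 _ _)|
      apply: weaken (h3 _)|apply: weaken (h4 _)] => //;
      (exact: enorm_ge0 || exact: jap_ge0).
  have [Cb hb] := flip i; have [Cs hs] := glip i.
  have [Cb' _ hb'] := growth_of_lip (flip i).
  have [Cs' _ hs'] := growth_of_lip (glip i).
  exists (`|Cb| + `|Cs| + `|Cb'| + `|Cs'|).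
  have := ler_norm Cb; have := ler_norm Cs; have := ler_norm Cb'.
  have := ler_norm Cs'; have := normr_ge0 Cb; have := normr_ge0 Cs.
  have := normr_ge0 Cb'; have := normr_ge0 Cs' => *.
  split=> *.
  - by apply: weaken (hb _ _); [exact: enorm_ge0|lra].
  - by apply: weaken (hs _ _); [exact: enorm_ge0|lra].
  - by apply: weaken (hb' _); [exact: jap_ge0|lra].
  - by apply: weaken (hs' _); [exact: jap_ge0|lra].
have [C3 C30 hC3] : exists2 C, 0 <= C & forall ij : 'I_q * 'I_q,
    forall x y, `|c ij.1 ij.2 x - c ij.1 ij.2 y| <= C * enorm (x - y).
  apply: common_constant => [[i j]|ij C C' CC' h3 x y]; first exact: clip.
  by apply: weaken (h3 x y) => //; exact: enorm_ge0.
have [c0 c00 hc0] : exists2 e, 0 < e & forall (ij : 'I_q * 'I_q) x,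
    ij.2 != ij.1 -> e <= c ij.1 ij.2 x.
  apply: (@common_lower_bound _ (fun ij : 'I_q * 'I_q => ij.2 != ij.1)
    (fun ij => c ij.1 ij.2)).
  by move=> [i j] /= ji; exact: coff.
pose L := C1 + C2 + C3.
have L0 : 0 <= L by rewrite !addr_ge0.
have L1 : C1 <= L by rewrite /L; lra.
have L2 : C2 <= L by rewrite /L; lra.
have L3 : C3 <= L by rewrite /L; lra.
have [b_lip s_lip b_gr s_gr] := hC1 tt.
have b_lip' x y : enorm (b x - b y) <= L * enorm (x - y).
  by apply: weaken (b_lip x y); rewrite ?enorm_ge0.
have s_lip' x y : enorm (sigma x - sigma y) <= L * enorm (x - y).
  by apply: weaken (s_lip x y); rewrite ?enorm_ge0.
have b_gr' x : enorm (b x) <= L * jap x.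
  by apply: weaken (b_gr x); rewrite ?jap_ge0.
have s_gr' x : enorm (sigma x) <= L * jap x.
  by apply: weaken (s_gr x); rewrite ?jap_ge0.
have f_lip i x y : `|f i x - f i y| <= L * enorm (x - y).
  by have [+ _ _ _] := hC2 i => /(_ x y); apply: weaken; rewrite ?enorm_ge0.
have g_lip i x y : `|g i x - g i y| <= L * enorm (x - y).
  by have [_ + _ _] := hC2 i => /(_ x y); apply: weaken; rewrite ?enorm_ge0.
have f_gr i x : `|f i x| <= L * jap x.
  by have [_ _ + _] := hC2 i => /(_ x); apply: weaken; rewrite ?jap_ge0.
have g_gr i x : `|g i x| <= L * jap x.
  by have [_ _ _ +] := hC2 i => /(_ x); apply: weaken; rewrite ?jap_ge0.
have c_lip i j x y : `|c i j x - c i j y| <= L * enorm (x - y).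
  by apply: weaken (hC3 (i, j) x y); rewrite ?enorm_ge0.
have c_off i j x : j != i -> c0 <= c i j x by exact: (hc0 (i, j)).
have growth a h n : 0 <= a -> 0 <= h -> h * n%:R <= T ->
    (1 + a * h) ^+ n <= expR (a * T).
  move=> a0 h0 hn; apply: (@le_trans _ _ (expR (a * h) ^+ n)).
    rewrite lerXn2r ?nnegrE ?expR_ge0 ?expR_ge1Dx//.
    by rewrite addr_ge0// mulr_ge0.
  by rewrite -expRM_natl ler_expR mulrC -mulrA ler_wpM2l.
pose Kd := moment_rate (d:=d) L.
have Kd0 : 0 <= Kd by exact: moment_rate_ge0.
pose Gam := L * expR ((Kd + 1) * T).
pose M := L * (1 + Gam) + 2 * Gam + c0 + 1.
pose B := (L + 2 * (L / (2 * c0)) * M ^+ 2) * expR ((Kd + 2) * T).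
have Gam0 : 0 <= Gam by rewrite mulr_ge0// expR_ge0.
have be0 : 0 <= L + 2 * (L / (2 * c0)) * M ^+ 2.
  by rewrite addr_ge0// mulr_ge0 ?sqr_ge0// mulr_ge0// divr_ge0// mulr_ge0// ltW.
have B0 : 0 <= B by rewrite mulr_ge0// expR_ge0.
pose C := (4 * B + 3 * Gam) * (1 + Kd).
have BG0 : 0 <= 4 * B + 3 * Gam by rewrite addr_ge0// mulr_ge0.
have C0 : 0 <= C by rewrite mulr_ge0// addr_ge0.
have BGC : 4 * B + 3 * Gam <= L + C.
  by rewrite (@le_trans _ _ C)// ?lerDr// /C ler_peMr// lerDl.
exists (L + C); first by rewrite addr_ge0.
split.
- move=> j x y; apply: weaken (f_lip j x y); rewrite ?enorm_ge0//.
  by rewrite lerDl.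
- move=> i j x y; apply: weaken (c_lip i j x y); rewrite ?enorm_ge0//.
  by rewrite lerDl.
- move=> h m n i h0 h1.
  exact: (lin_growth_value L0 h0 h1 b_lip' s_lip' f_lip g_lip c_lip).
move=> h m n i x y h0 h1 hn /=.
have Gge k : (k <= n)%N -> L * (1 + (Kd + 1) * h) ^+ k <= Gam.
  move=> kn; rewrite ler_wpM2l//; apply: growth => //.
    by rewrite addr_ge0.
  by rewrite (le_trans _ hn)// ler_wpM2l// ler_nat.
have Bge k : (k <= n)%N -> (L + 2 * (L / (2 * c0)) * M ^+ 2) *
    (1 + (Kd + 2) * h) ^+ k <= B.
  move=> kn; rewrite ler_wpM2l//; apply: growth => //.
    by rewrite addr_ge0.
  by rewrite (le_trans _ hn)// ler_wpM2l// ler_nat.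
split.
- apply: (weaken _ _ _ _ _ BGC); first by rewrite mulr_ge0 ?jap_ge0 ?enorm_ge0.
  exact: (value_loc_lipschitz L0 c00 h0 h1 b_lip' b_gr' s_lip' s_gr' f_lip f_gr
    g_lip g_gr c_lip cdiag c_off Gge Bge m i x y (leqnn n)).
- apply: (@weaken C); rewrite ?lerDr//.
    by rewrite mulr_ge0 ?jap_ge0 ?enorm_ge0.
  exact: (kernel_loc_lipschitz L0 c00 h0 h1 b_lip' b_gr' s_lip' s_gr' f_lip f_gr
    g_lip g_gr c_lip cdiag c_off Gge Bge m i x y (leqnn n)).
Qed.

End uniform_regularity.

(** * Lebesgue norms of random variables *)

Section lp_norms.
Context {R : realType} {disp : measure_display} {Omega : measurableType disp}.
Variable P : probability Omega R.
Implicit Types (Y Z : Omega -> R) (p r s : R).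

Lemma normRVE p Y : normRV P p Y = ((\int[P]_x (`|Y x| `^ p)%:E) `^ p^-1)%E.
Proof. by rewrite /normRV unlock. Qed.

Lemma normRV_ge0 p Y : (0 <= normRV P p Y)%E.
Proof. exact: Lnorm_ge0. Qed.

Lemma powR_normRV p Y : 0 < p ->
  (normRV P p Y `^ p = \int[P]_x (`|Y x| `^ p)%:E)%E.
Proof. by move=> p0; rewrite /normRV poweR_Lnorm// gt_eqF. Qed.

Lemma measurable_powR_comp p Y : measurable_fun setT Y ->
  measurable_fun setT (fun x => Y x `^ p).
Proof. exact: (measurableT_comp (measurable_powR p)). Qed.

Lemma measurable_abs_powR p Y : measurable_fun setT Y ->
  measurable_fun setT (fun x => (`|Y x| `^ p)%:E).
Proof.
move=> mY; apply/measurable_EFinP; apply: measurable_powR_comp.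
exact: measurableT_comp.
Qed.

Lemma le_normRV_ae p Y Z : 0 < p -> measurable_fun setT Y ->
  measurable_fun setT Z -> {ae P, forall x, `|Y x| <= `|Z x|} ->
  (normRV P p Y <= normRV P p Z)%E.
Proof.
move=> p0 mY mZ YZ; rewrite !normRVE.
apply: gt0_ler_poweR; rewrite ?invr_ge0 ?(ltW p0)//.
- rewrite in_itv/= leey andbT; apply: integral_ge0 => x _.
  by rewrite lee_fin powR_ge0.
- rewrite in_itv/= leey andbT; apply: integral_ge0 => x _.
  by rewrite lee_fin powR_ge0.
apply: ae_ge0_le_integral => //.
- exact: measurable_abs_powR.
- exact: measurable_abs_powR.
apply: filterS YZ => x YZx _; rewrite lee_fin ge0_ler_powR ?nnegrE//.
exact: ltW.
Qed.

Lemma le_normRV p Y Z : 0 < p -> measurable_fun setT Y ->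
  measurable_fun setT Z -> (forall x, `|Y x| <= `|Z x|) ->
  (normRV P p Y <= normRV P p Z)%E.
Proof. by move=> p0 mY mZ YZ; apply: le_normRV_ae => //; exact: aeW. Qed.

Lemma normRVZ p (a : R) Y : 0 < p -> 0 <= a -> measurable_fun setT Y ->
  (normRV P p (fun x => a * Y x)%R = a%:E * normRV P p Y)%E.
Proof.
move=> p0 a0 mY; rewrite !normRVE.
under eq_integral do rewrite normrM powRM// EFinM (ger0_norm a0).
have i0 : (0 <= \int[P]_x (`|Y x| `^ p)%:E)%E.
  by apply: integral_ge0 => x _; rewrite lee_fin powR_ge0.
rewrite ge0_integralZl//; last 2 first.
- exact: measurable_abs_powR.
- by rewrite lee_fin powR_ge0.
rewrite poweRM ?lee_fin ?powR_ge0// poweR_EFin -powRrM mulfV ?gt_eqF//.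
by rewrite powRr1.
Qed.

Lemma normRV_cst1 p : normRV P p (fun=> 1) = 1%E.
Proof.
rewrite normRVE; under eq_integral do rewrite normr1 powR1.
by rewrite integral_prob_cst poweR1r.
Qed.

(** Hoelder's inequality for three exponents reduces to the conjugate case by
    applying it to the [p]-th powers. *)
Lemma hoelder_normRV p r s Y Z : 0 < p -> 0 < r -> 0 < s ->
  p^-1 = r^-1 + s^-1 -> measurable_fun setT Y -> measurable_fun setT Z ->
  (normRV P p (fun x => Y x * Z x)%R <= normRV P r Y * normRV P s Z)%E.
Proof.
move=> p0 r0 s0 prs mY mZ.
have mp (V : Omega -> R) : measurable_fun setT V ->
    measurable_fun setT (fun x => `|V x| `^ p).
  by move=> mV; apply: measurable_powR_comp; exact: measurableT_comp.
have := @hoelder _ _ _ P (fun x => `|Y x| `^ p) (fun x => `|Z x| `^ p)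
  (r / p) (s / p) (mp _ mY) (mp _ mZ).
rewrite !divr_gt0// !invf_div => /(_ isT isT).
have -> : p / r + p / s = 1 by rewrite -mulrDr -prs mulfV// gt_eqF.
move=> /(_ erefl).
have powE t (V : Omega -> R) : 0 < t ->
    ('N[P]_(t / p)%:E[EFin \o (fun x => `|V x| `^ p)%R] =
    normRV P t V `^ p)%E.
  move=> t0; rewrite unlock/= normRVE -poweRrM invf_div [p / t]mulrC.
  congr poweR; apply: eq_integral => x _.
  rewrite /= (ger0_norm (powR_ge0 _ _)) -powRrM mulrC divfK//.
  by rewrite gt_eqF.
rewrite !powE// -poweRM ?normRV_ge0// => H.
have : (normRV P p (fun x => Y x * Z x)%R `^ p <=
    (normRV P r Y * normRV P s Z) `^ p)%E.
  apply: le_trans H; rewrite powR_normRV// Lnorm1.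
  apply: ge0_le_integral => //.
  - by apply: measurable_abs_powR; exact: measurable_funM.
  - by apply/measurable_EFinP; apply: measurableT_comp => //;
      apply: measurable_funM; exact: mp.
  move=> x _; rewrite /= lee_fin [X in _ <= X]ger0_norm ?mulr_ge0 ?powR_ge0//.
  by rewrite normrM powRM.
move=> /(gt0_ler_poweR (r := p^-1)).
rewrite -!poweRrM mulfV ?gt_eqF// !poweRe1 ?mule_ge0 ?normRV_ge0//.
apply; rewrite ?invr_ge0 ?ltW// in_itv/= leey andbT poweR_ge0//.
Qed.

Lemma integrable_normRV p Y : 1 < p -> measurable_fun setT Y ->
  (normRV P p Y < +oo)%E -> P.-integrable setT (EFin \o Y).
Proof.
move=> p1 mY Yoo; have p0 : 0 < p by lra.
apply/integrableP; split; first exact/measurable_EFinP.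
have Ypoo : (\int[P]_x (`|Y x| `^ p)%:E < +oo)%E.
  by rewrite -powR_normRV// poweR_lty.
apply: (@le_lt_trans _ _ (\int[P]_x (1 + `|Y x| `^ p)%:E)%E).
  apply: ge0_le_integral => //=.
  - by apply/measurable_EFinP; exact: measurableT_comp.
  - apply/measurable_EFinP; apply: measurable_funD => //.
    by apply/measurable_EFinP; exact: measurable_abs_powR.
  move=> x _; rewrite lee_fin.
  have [Y1|Y1] := leP `|Y x| 1.
    by rewrite (le_trans Y1)// lerDl powR_ge0.
  rewrite (@le_trans _ _ (`|Y x| `^ p)) ?lerDr//.
  rewrite -[X in X <= _]powRr1//; apply: ler_powR; first exact: ltW.
  exact: ltW.
under eq_integral do rewrite EFinD.
rewrite ge0_integralD//=; last exact: measurable_abs_powR.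
by rewrite lte_add_pinfty// integral_prob_cst ltry.
Qed.

End lp_norms.

(** * Conditioning on a finite-valued variable *)

Section finite_conditioning.
Context {R : realType} {disp : measure_display} {Omega : measurableType disp}.
Variables (P : probability Omega R) (K : eqType) (S : Omega -> K) (G : seq K).
Hypotheses (uG : uniq G) (SG : forall omega, S omega \in G)
  (mS : forall x, measurable (S @^-1` [set x])).
Implicit Types (Y Z : Omega -> R).

Local Notation cell x := (S @^-1` [set x]).

Lemma sum_indic_cell (H : K -> R) omega :
  \sum_(x <- G) \1_(cell x) omega * H x = H (S omega).
Proof.
rewrite (bigD1_seq (S omega))//= indicE mem_set// mul1r big1 ?addr0// => x xS.
by rewrite indicE memNset ?mul0r//= => /esym/eqP; rewrite (negbTE xS).
Qed.

Lemma measurable_finite_valued (H : K -> R) :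
  measurable_fun setT (fun omega => H (S omega)).
Proof.
under eq_fun do rewrite -sum_indic_cell.
by apply: measurable_sum => x; apply: measurable_funM.
Qed.

(** The conditional expectation of [Z] given [S], as a function of the value of
    [S]; it vanishes at the values that have probability zero. *)
Definition cell_mean Z (x : K) : R :=
  (\int[P]_(omega in cell x) Z omega) / fine (P (cell x)).

Lemma cell_mean_ge0 Z x : (forall omega, 0 <= Z omega) -> 0 <= cell_mean Z x.
Proof.
move=> Z0; apply: divr_ge0; last exact: fine_ge0.
by apply: Rintegral_ge0 => w _; exact: Z0.
Qed.

Let integral_cell (H : Omega -> R) : measurable_fun setT H ->
  (forall omega, 0 <= H omega) ->
  (\int[P]_omega (H omega)%:E =
   \sum_(x <- G) \int[P]_(omega in cell x) (H omega)%:E)%E.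
Proof.
move=> mH H0.
transitivity (\int[P]_omega \sum_(x <- G) (\1_(cell x) omega * H omega)%:E)%E.
  apply: eq_integral => omega _.
  by rewrite sumEFin (sum_indic_cell (fun=> H omega)).
rewrite ge0_integral_sum//; last 2 first.
- by move=> x; apply/measurable_EFinP; exact: measurable_funM.
- by move=> x omega _; rewrite lee_fin mulr_ge0.
apply: eq_bigr => x _; rewrite [RHS]integral_mkcond; apply: eq_integral => w _.
rewrite patchE indicE; case: (w \in _); first by rewrite mul1r.
by rewrite mul0r.
Qed.

(** Jensen's inequality on each cell, in the form of the tangent line of the
    convex function [z ^ p] at the mean of the cell. *)
Lemma normRV_cell_mean p Z : 1 < p -> measurable_fun setT Z ->
  (forall omega, 0 <= Z omega) ->
  (normRV P p (fun omega => cell_mean Z (S omega)) <= normRV P p Z)%E.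
Proof.
move=> p1 mZ Z0; have p0 : 0 < p by lra.
have [->|Zfin] := eqVneq (normRV P p Z) +oo%E; first exact: leey.
have Zlty : (normRV P p Z < +oo)%E by rewrite ltey.
have iZ := integrable_normRV p1 mZ Zlty.
have mZp : measurable_fun setT (fun w => `|Z w| `^ p).
  by apply/measurable_EFinP; exact: measurable_abs_powR.
have iZp : P.-integrable setT (EFin \o (fun w => `|Z w| `^ p)).
  apply/integrableP; split; first exact/measurable_EFinP.
  under eq_integral do rewrite /= ger0_norm ?powR_ge0//.
  by rewrite -powR_normRV// poweR_lty.
have mC : measurable_fun setT (fun w => cell_mean Z (S w)).
  exact: measurable_finite_valued.
rewrite !normRVE; apply: gt0_ler_poweR; rewrite ?invr_ge0 ?(ltW p0)//.
- rewrite in_itv/= leey andbT; apply: integral_ge0 => x _.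
  by rewrite lee_fin powR_ge0.
- rewrite in_itv/= leey andbT; apply: integral_ge0 => x _.
  by rewrite lee_fin powR_ge0.
rewrite !integral_cell; [|by []|by move=> w; exact: powR_ge0|
  by apply/measurable_EFinP; exact: measurable_abs_powR|
  by move=> w; exact: powR_ge0].
apply: lee_sum => x _.
set a := cell_mean Z x; have a0 : 0 <= a by exact: cell_mean_ge0.
have iZx : P.-integrable (cell x) (EFin \o Z).
  by apply: integrableS iZ.
have iZpx : P.-integrable (cell x) (EFin \o (fun w => `|Z w| `^ p)).
  by apply: integrableS iZp.
rewrite (eq_integral (fun=> (a `^ p)%:E)); last first.
  by move=> w /[!inE] /= ->; rewrite ger0_norm.
pose pr := fine (P (cell x)).
have -> : (\int[P]_(w in cell x) (a `^ p)%:E = (a `^ p * pr)%:E)%E.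
  rewrite integral_cst// EFinM; congr (_ * _)%E.
  by rewrite fineK// fin_num_measure.
rewrite -[X in (_ <= X)%E]fineK; last exact: integrable_fin_num.
rewrite lee_fin; pose I := \int[P]_(w in cell x) (`|Z w| `^ p).
rewrite -[X in _ <= X]/I.
have pr0 : 0 <= pr by exact: fine_ge0.
have I0 : 0 <= I by apply: Rintegral_ge0 => w _; exact: powR_ge0.
have [->|prn0] := eqVneq pr 0; first by rewrite mulr0.
have aE : \int[P]_(w in cell x) Z w = a * pr by rewrite /a /cell_mean divfK.
pose p' := p / (p - 1).
have p'0 : 0 < p' by rewrite divr_gt0// subr_gt0.
have pp' : p^-1 + p'^-1 = 1.
  by rewrite /p' invf_div; field; rewrite !gt_eqF// subr_gt0.
have young w : Z w * a `^ (p - 1) <= `|Z w| `^ p / p + a `^ p / p'.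
  have := conjugate_powR (Z0 w) (powR_ge0 a (p - 1)) p0 p'0 pp'.
  by rewrite -powRrM /p' mulrCA mulfV ?mulr1 ?ger0_norm// gt_eqF// subr_gt0.
have : a `^ (p - 1) * (a * pr) <= p^-1 * I + a `^ p / p' * pr.
  have icst : P.-integrable (cell x) (EFin \o cst (a `^ p / p')).
    exact: finite_measure_integrable_cst.
  have -> : p^-1 * I + a `^ p / p' * pr =
      \int[P]_(w in cell x) (p^-1 * `|Z w| `^ p + a `^ p / p').
    rewrite RintegralD//; last exact: (integrableZl _ p^-1 iZpx).
    by rewrite (Rintegral_cst P (mS x)) RintegralZl.
  rewrite -aE -RintegralZl//.
  apply: le_Rintegral => //.
  - exact: (integrableZl _ _ iZx).
  - exact: (integrableD (mS x) (integrableZl (mS x) p^-1 iZpx) icst).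
  - by move=> w _; rewrite mulrC [_^-1 * _]mulrC.
have -> : a `^ (p - 1) * (a * pr) = a `^ p * pr.
  by rewrite mulrCA mulrA mulr_powRB1.
have -> : a `^ p / p' * pr = a `^ p * pr - p^-1 * (a `^ p * pr).
  have -> : p'^-1 = 1 - p^-1 by lra.
  ring.
move=> H; rewrite -(@ler_pM2l _ p^-1) ?invr_gt0//; lra.
Qed.

Lemma ae_cell_gt0 : {ae P, forall omega, 0 < fine (P (cell (S omega)))}.
Proof.
pose A := [set omega | fine (P (cell (S omega))) = 0].
have mA : measurable A.
  rewrite -[A]setTI.
  exact: (measurable_finite_valued (fun x => fine (P (cell x))) measurableT
    (measurable_set1 0)).
exists A; split=> //; last first.
  move=> omega /= /negP; rewrite -leNgt => h.
  by apply/eqP; rewrite eq_le h fine_ge0.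
have mind : measurable_fun setT (\1_A : Omega -> R) by exact: measurable_indic.
have := integral_cell mind (fun=> ler0n _ _).
rewrite integral_indic// setIT => ->; apply: big1 => x _.
rewrite integral_indic//.
have [Px0|Pxn0] := eqVneq (fine (P (cell x))) 0; last first.
  rewrite (_ : A `&` _ = set0) ?measure0//; apply/seteqP; split=> // w [/= Aw Sw].
  by move: Pxn0; rewrite -Sw => /eqP.
apply/eqP; rewrite -measure_le0; apply: (@le_trans _ _ (P (cell x))).
  by apply: le_measure; rewrite ?inE//; exact: measurableI.
by rewrite -[leLHS]fineK ?fin_num_measure// Px0.
Qed.

Lemma integrable_finite_valued (H : K -> R) :
  P.-integrable setT (EFin \o (fun omega => H (S omega))).
Proof.
pose M := \sum_(x <- G) `|H x|.
apply: (le_integrable measurableT (g := EFin \o cst M)).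
- by apply/measurable_EFinP; exact: measurable_finite_valued.
- move=> omega _; rewrite /= lee_fin (le_trans _ (ler_norm _))//.
  by rewrite /M (bigD1_seq (S omega))//= lerDl sumr_ge0.
- exact: finite_measure_integrable_cst.
Qed.

Lemma Rintegral_cell_finite_valued (K' : eqType) (S' : Omega -> K')
    (G' : seq K') (H : K' -> R) x : uniq G' ->
  (forall omega, S' omega \in G') ->
  (forall y, measurable (S' @^-1` [set y])) ->
  \int[P]_(omega in cell x) H (S' omega) =
  \sum_(y <- G') fine (P (cell x `&` S' @^-1` [set y])) * H y.
Proof.
move=> uG' SG' mS'; have mc := mS x.
have term y : (\int[P]_(omega in cell x) (\1_(S' @^-1` [set y]) omega * H y)%:E =
    (fine (P (cell x `&` S' @^-1` [set y])) * H y)%:E)%E.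
  under eq_integral do rewrite EFinM muleC.
  rewrite integralZl//; last first.
    by apply: (integrableS measurableT) => //; exact: integrable_indic.
  rewrite (integral_indic _ mc (mS' y)) (setIC (S' @^-1` _)).
  have PE : (P (cell x `&` S' @^-1` [set y]) =
      (fine (P (cell x `&` S' @^-1` [set y])))%:E)%E.
    by rewrite fineK// fin_num_measure//; exact: measurableI.
  by rewrite [X in (_ * X)%E]PE -EFinM mulrC.
rewrite /Rintegral.
transitivity (fine (\int[P]_(omega in cell x)
    (\sum_(y <- G') (\1_(S' @^-1` [set y]) omega * H y)%:E)))%E.
  congr fine; apply: eq_integral => omega _; rewrite sumEFin; congr EFin.
  rewrite (bigD1_seq (S' omega))//= indicE mem_set// mul1r big1 ?addr0//.
  move=> y yS; rewrite indicE memNset ?mul0r//= => /esym/eqP.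
  by rewrite (negbTE yS).
rewrite integral_sum//; last first.
  move=> y; apply: (integrableS measurableT) => //.
  rewrite (_ : (fun _ => _) = fun omega =>
      ((H y)%:E * (\1_(S' @^-1` [set y]) omega)%:E)%E).
    by apply: integrableZl => //; exact: integrable_indic.
  by apply/funext => omega; rewrite -EFinM mulrC.
by under eq_bigr do rewrite term; rewrite sumEFin.
Qed.

(** Comparison of a constant with a conditional mean: [U] and [V] have the same
    mean on the cell, so that the difference splits into two local errors. *)
Lemma cell_mean_compare (U V V' D D' : Omega -> R) (a : R) x :
  0 < fine (P (cell x)) ->
  P.-integrable (cell x) (EFin \o U) -> P.-integrable (cell x) (EFin \o V) ->
  P.-integrable (cell x) (EFin \o V') -> P.-integrable (cell x) (EFin \o D) ->
  P.-integrable (cell x) (EFin \o D') ->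
  \int[P]_(omega in cell x) U omega = \int[P]_(omega in cell x) V omega ->
  (forall omega, S omega = x -> `|a - U omega| <= D omega) ->
  (forall omega, S omega = x -> `|V omega - V' omega| <= D' omega) ->
  `|a - cell_mean V' x| <= cell_mean (fun omega => D omega + D' omega) x.
Proof.
move=> Px iU iV iV' iD iD' UV hD hD'.
set pr := fine _ in Px.
have ia : P.-integrable (cell x) (EFin \o cst a).
  exact: finite_measure_integrable_cst.
have aE : a = (\int[P]_(omega in cell x) cst a omega) / pr.
  by rewrite (Rintegral_cst P (mS x)) mulfK// gt_eqF.
have iaU := integrableB (mS x) ia iU; have iVV := integrableB (mS x) iV iV'.
have -> : a - cell_mean V' x =
    (\int[P]_(omega in cell x) ((a - U omega) + (V omega - V' omega))) / pr.
  have -> : \int[P]_(omega in cell x) ((a - U omega) + (V omega - V' omega)) =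
      \int[P]_(omega in cell x) (cst a omega) -
      \int[P]_(omega in cell x) V' omega.
    rewrite (RintegralD (mS x) iaU iVV).
    by rewrite (RintegralB (mS x) ia iU) (RintegralB (mS x) iV iV') UV; lra.
  by rewrite mulrBl -aE.
have Pi : 0 < pr^-1 by rewrite invr_gt0.
rewrite normrM (gtr0_norm Pi) /cell_mean -/pr (ler_pM2r Pi).
have isum := integrableD (mS x) iaU iVV.
apply: (le_trans (le_normr_Rintegral (mS x) isum)).
apply: le_Rintegral => //.
- exact: integrable_norm isum.
- exact: (integrableD (mS x) iD iD').
- move=> omega Sx; apply: (le_trans (ler_normD _ _)).
  by apply: lerD; [exact: hD|exact: hD'].
Qed.

End finite_conditioning.

(** * The Euler chain as a Markov chain *)

(** Gives access to the closure properties of measurable functions for a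
    sigma-algebra of past events. *)
Lemma sub_measurableP {R : realType} {disp} {Omega : measurableType disp} d
    (G : set (set Omega)) (X : Omega -> 'cV[R]_d) : sigma_algebra setT G ->
  sub_measurable G X <->
  measurable_fun [set: g_sigma_algebraType G] (X : g_sigma_algebraType G -> _).
Proof.
move=> sG; split=> [hX _ A mA|hX A mA].
  by rewrite setTI; apply: sub_sigma_algebra; exact: hX.
have := hX measurableT A mA; rewrite setTI.
by rewrite (measurable_g_measurableTypeE sG).
Qed.

Lemma measurable_euler_step {R : realType} {d} (b : 'cV[R]_d -> 'cV[R]_d)
    (sigma : 'cV[R]_d -> 'M[R]_d) (h : R) :
  lipschitz_mx b -> lipschitz_mx sigma ->
  measurable_fun setT
    (fun z : 'cV[R]_d * 'cV[R]_d => euler_step b sigma h z.1 z.2).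
Proof.
move=> lb ls; apply: measurable_cVP => i.
rewrite [X in measurable_fun _ X](_ : _ = fun z : 'cV[R]_d * 'cV[R]_d =>
    z.1 i ord0 + h * b z.1 i ord0 +
    Num.sqrt h * \sum_j sigma z.1 i j * z.2 j ord0); last first.
  by apply/funext => z; rewrite /euler_step !mxE.
have m1 phi : measurable_fun setT phi ->
    measurable_fun setT (fun z : 'cV[R]_d * 'cV[R]_d => phi z.1 : R).
  by move=> mphi; exact: (measurableT_comp mphi measurable_fst).
have m2 phi : measurable_fun setT phi ->
    measurable_fun setT (fun z : 'cV[R]_d * 'cV[R]_d => phi z.2 : R).
  by move=> mphi; exact: (measurableT_comp mphi measurable_snd).
apply: measurable_funD.
  apply: measurable_funD; first exact: (m1 _ (@measurable_coord _ R d i)).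
  apply: measurable_funM => //.
  exact: (m1 _ (measurable_lipschitz_mx i ord0 lb)).
apply: measurable_funM => //; apply: measurable_sum => j.
apply: measurable_funM; first exact: (m1 _ (measurable_lipschitz_mx i j ls)).
exact: (m2 _ (@measurable_coord _ R d j)).
Qed.

Section euler_chain.
Context {R : realType} {disp : measure_display} {Omega : measurableType disp}.
Variables (P : probability Omega R) (F : R -> set (set Omega)).
Hypothesis hF : usual_filtration P F.
Context {d : nat}.
Variables (W : R -> Omega -> 'cV[R]_d).
Hypothesis hW : brownian_motion P F W.
Variables (b : 'cV[R]_d -> 'cV[R]_d) (sigma : 'cV[R]_d -> 'M[R]_d).
Hypotheses (lb : lipschitz_mx b) (ls : lipschitz_mx sigma).
Variables (h : R) (h0 : 0 < h) (X0 : Omega -> 'cV[R]_d).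
Hypothesis mX0 : sub_measurable (F 0) X0.

Local Notation X := (Xbar b sigma W h X0).
Local Notation theta := (theta W h).
Local Notation gam := (@std_gaussian R d).

Let time_ge0 k : 0 <= k%:R * h. Proof. by rewrite mulr_ge0// ltW. Qed.

Let time_lt k : k%:R * h < k.+1%:R * h.
Proof. by rewrite ltr_pM2r// ltr_nat. Qed.

Let sF t : 0 <= t -> sigma_algebra setT (F t).
Proof. by case: hF => + _ _ _ => /[apply] -[]. Qed.

Let F_le u t A : 0 <= u -> u <= t -> F u A -> F t A.
Proof. by move=> u0 ut; case: hF => _ + _ _ => /(_ u t u0 ut); apply. Qed.

Lemma theta_adapted k : sub_measurable (F (k.+1%:R * h)) (theta k).
Proof.
have [hWa _ _ _ _] := hW.
apply/sub_measurableP; first exact: sF.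
have mW u : 0 <= u -> u <= k.+1%:R * h -> measurable_fun
    [set: g_sigma_algebraType (F (k.+1%:R * h))]
    (W u : g_sigma_algebraType _ -> _).
  move=> u0 ut; apply/sub_measurableP; first exact: sF.
  by move=> A mA; apply: (F_le u0 ut); exact: hWa.
have m1 := mW _ (time_ge0 k) (ltW (time_lt k)).
have m2 := mW _ (time_ge0 k.+1) (lexx _).
apply: measurable_cVP => i.
under eq_fun do rewrite /theta /increment !mxE.
apply: measurable_funM => //; apply: measurable_funB.
  exact: (measurableT_comp (@measurable_coord _ R d i) m2).
exact: (measurableT_comp (@measurable_coord _ R d i) m1).
Qed.

Lemma Xbar_adapted k : sub_measurable (F (k%:R * h)) (X k).
Proof.
elim: k => [|k IHk]; first by rewrite mul0r.
apply/sub_measurableP; first exact: sF.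
have mX : measurable_fun [set: g_sigma_algebraType (F (k.+1%:R * h))]
    (X k : g_sigma_algebraType _ -> _).
  apply/sub_measurableP; first exact: sF.
  move=> A mA; apply: (F_le (time_ge0 k) (ltW (time_lt k))).
  exact: IHk.
have mth : measurable_fun [set: g_sigma_algebraType (F (k.+1%:R * h))]
    (theta k : g_sigma_algebraType _ -> _).
  by apply/sub_measurableP; [exact: sF|exact: theta_adapted].
exact: (measurableT_comp (measurable_euler_step h lb ls)
  (measurable_fun_pair mX mth)).
Qed.

Let adapted_measurable t (Y : Omega -> 'cV[R]_d) : 0 <= t ->
  sub_measurable (F t) Y -> measurable_fun setT Y.
Proof.
move=> t0 hY _ A mA; rewrite setTI.
by case: hF => + _ _ _ => /(_ t t0)[_]; apply; exact: hY.
Qed.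

Lemma measurable_Xbar k : measurable_fun setT (X k).
Proof. exact: adapted_measurable (time_ge0 k) (Xbar_adapted k). Qed.

Lemma measurable_theta k : measurable_fun setT (theta k).
Proof. exact: adapted_measurable (time_ge0 k.+1) (theta_adapted k). Qed.

(** The state belongs to the past of the increment, and the normalization cancels
    the factor [sqrt h] in the law of the increment. *)
Lemma Xbar_theta_law k (B A : set 'cV[R]_d) : measurable B -> measurable A ->
  P (X k @^-1` B `&` theta k @^-1` A) = (P (X k @^-1` B) * gam A)%E.
Proof.
move=> mB mA; have [_ _ _ hind hlaw] := hW.
pose A' := (fun z : 'cV[R]_d => (Num.sqrt h)^-1 *: z) @^-1` A.
have mA' : measurable A'.
  rewrite -[A']setTI; apply: (measurable_cVP _ measurableT mA) => i.
  under eq_fun do rewrite mxE.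
  by apply: measurable_funM => //; exact: measurable_coord.
have -> : theta k @^-1` A = increment W (k%:R * h) (k.+1%:R * h) @^-1` A'.
  by [].
rewrite hind//; last exact: Xbar_adapted.
congr (_ * _)%E; rewrite hlaw//; congr (gam _); apply/funext => z.
rewrite /A' /preimage/= -natr1 mulrDl mul1r addrC addKr scalerA mulVf ?scale1r//.
by rewrite gt_eqF// sqrtr_gt0.
Qed.

Let prob_of (Y : Omega -> 'cV[R]_d) (mY : measurable_fun setT Y) :
    probability 'cV[R]_d R :=
  distribution P (HB.pack_for {mfun Omega >-> 'cV[R]_d} Y
    (isMeasurableFun.Build _ _ _ _ Y mY)).

Let law k := prob_of (measurable_Xbar k).

Let joint k omega := (X k omega, theta k omega).

Let measurable_joint k : measurable_fun setT (joint k).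
Proof. exact: measurable_fun_pair (measurable_Xbar k) (measurable_theta k). Qed.

(* A measure that agrees with the product measure on rectangles equals it, so
   that Fubini's theorem applies to the joint law of state and noise. *)
Let integral_joint k (G : 'cV[R]_d * 'cV[R]_d -> \bar R) :
  measurable_fun setT G -> P.-integrable setT (G \o joint k) ->
  (law k \x gam)%E.-integrable setT G /\
  (\int[law k]_x \int[gam]_w G (x, w) = \int[P]_omega G (joint k omega))%E.
Proof.
move=> mG iG.
have E A : measurable A -> (law k \x gam)%E A = pushforward P (joint k) A.
  apply: product_measure_unique => A' B' mA' mB'.
  rewrite [LHS](_ : _ = P (X k @^-1` A' `&` theta k @^-1` B')) //.
  exact: Xbar_theta_law.
have iG' : (law k \x gam)%E.-integrable setT G.
  apply/integrableP; split => //.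
  rewrite (eq_measure_integral (pushforward P (joint k))); last first.
    by move=> A mA _; exact: E.
  have /integrableP[_] := integrable_pushforward (measurable_joint k) mG iG
    measurableT.
  by [].
split=> //; transitivity (\int[(law k \x gam)%E]_z G z)%E.
  by rewrite -integral12_prod_meas1.
rewrite (eq_measure_integral (pushforward P (joint k))); last first.
  by move=> A mA _; exact: E.
by rewrite integral_pushforward//; exact: measurable_joint.
Qed.

(** The Markov property, in the integrated form that conditioning on a
    function of the current state requires. *)
Lemma one_step_expectation k (B : set 'cV[R]_d) (phi : 'cV[R]_d -> R) :
  measurable B -> lin_growth phi ->
  P.-integrable setT (EFin \o (phi \o X k.+1)) ->
  P.-integrable (X k @^-1` B)
    (EFin \o (trans_kernel b sigma h phi \o X k)) /\
  \int[P]_(omega in X k @^-1` B) trans_kernel b sigma h phi (X k omega) =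
  \int[P]_(omega in X k @^-1` B) phi (X k.+1 omega).
Proof.
move=> mB lphi iphi.
have mXB : measurable (X k @^-1` B).
  by rewrite -[X in measurable X]setTI; exact: measurable_Xbar.
pose G (z : 'cV[R]_d * 'cV[R]_d) : \bar R :=
  (\1_B z.1 * phi (euler_step b sigma h z.1 z.2))%:E.
have mG : measurable_fun setT G.
  apply/measurable_EFinP; apply: measurable_funM.
    by apply: (measurableT_comp _ measurable_fst); exact: measurable_indic.
  exact: (measurableT_comp lphi.1 (measurable_euler_step h lb ls)).
have GE omega : G (joint k omega) =
    ((fun omega => (phi (X k.+1 omega))%:E) \_ (X k @^-1` B)) omega.
  by rewrite /G /= patchE indicE -[omega \in _]/(X k omega \in B); case: ifP => _;
    rewrite ?mul1r ?mul0r.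
have iG : P.-integrable setT (G \o joint k).
  apply: (eq_integrable measurableT
    ((fun omega => (phi (X k.+1 omega))%:E) \_ (X k @^-1` B))).
    by move=> omega _; rewrite -GE.
  by rewrite -integrable_mkcond//; apply: integrableS iphi.
have [iGp EG] := integral_joint mG iG.
have kerE x : (\int[gam]_w G (x, w) =
    (\1_B x * trans_kernel b sigma h phi x)%:E)%E.
  rewrite /G/= /trans_kernel.
  have ix := lin_growth_integrable (lin_growth_affine x (b x) (sigma x) h lphi).
  under eq_integral do rewrite EFinM.
  rewrite integralZl// EFinM; congr (_ * _)%E.
  by rewrite /Rintegral fineK//; exact: integrable_fin_num.
have ilaw : (law k).-integrable setT
    (fun x => (\1_B x * trans_kernel b sigma h phi x)%:E).
  apply: (eq_integrable measurableT _ _ _ (integrable_fubini_F iGp)).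
  by move=> x _; rewrite /fubini_F kerE.
have mker := measurable_int _ ilaw.
have ipull : P.-integrable setT
    ((fun x => (\1_B x * trans_kernel b sigma h phi x)%:E) \o X k).
  apply/integrableP; split.
    by apply: measurableT_comp => //; exact: measurable_Xbar.
  have /integrableP[_] := ilaw; rewrite ge0_integral_distribution//.
  exact: measurableT_comp.
have pullE omega : ((fun x => (\1_B x * trans_kernel b sigma h phi x)%:E) \o X k)
    omega = ((fun omega => (trans_kernel b sigma h phi (X k omega))%:E) \_
      (X k @^-1` B)) omega.
  by rewrite /= patchE indicE -[omega \in _]/(X k omega \in B); case: ifP => _;
    rewrite ?mul1r ?mul0r.
split.
  rewrite integrable_mkcond//; apply: (eq_integrable measurableT _ _ _ ipull).
  by move=> omega _; rewrite pullE.
rewrite /Rintegral; congr fine; rewrite [LHS]integral_mkcond [RHS]integral_mkcond.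
under eq_integral do rewrite -pullE.
under [RHS]eq_integral do rewrite -GE.
rewrite -EG; under [RHS]eq_integral do rewrite kerE.
by rewrite integral_distribution.
Qed.

End euler_chain.

(** * Propagation of the quantization error *)

Section quantization_error.
Context {R : realType} {disp : measure_display} {Omega : measurableType disp}.
Variables (P : probability Omega R) (F : R -> set (set Omega)).
Hypothesis hF : usual_filtration P F.
Context {d q : nat}.
Variables (W : R -> Omega -> 'cV[R]_d).
Hypothesis hW : brownian_motion P F W.
Variables (b : 'cV[R]_d -> 'cV[R]_d) (sigma : 'cV[R]_d -> 'M[R]_d).
Variables (f g : 'I_q -> 'cV[R]_d -> R) (c : 'I_q -> 'I_q -> 'cV[R]_d -> R).
Hypotheses (lb : lipschitz_mx b) (ls : lipschitz_mx sigma).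
Variables (h : R) (m : nat).
Hypotheses (h0 : 0 < h) (h1 : h <= 1).
Variables (X0 : Omega -> 'cV[R]_d).
Hypothesis mX0 : sub_measurable (F 0) X0.
Variables (Gamma : nat -> {fset 'cV[R]_d}) (Proj : nat -> 'cV[R]_d -> 'cV[R]_d).
Hypothesis hProj : forall k, (k <= m)%N -> nearest_proj (Gamma k) (Proj k).

Local Notation v n i := (backward f g c (fun=> trans_kernel b sigma h) h m n i).

Variable C : R.
Hypotheses (C0 : 0 < C)
  (f_lip : forall j x y, `|f j x - f j y| <= C * enorm (x - y))
  (c_lip : forall i j x y, `|c i j x - c i j y| <= C * enorm (x - y))
  (v_growth : forall n i, lin_growth (v n i))
  (v_lip : forall n i x y, (n <= m)%N ->
     `|v n i x - v n i y| <= C * (jap y * enorm (x - y)))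
  (ker_lip : forall n i x y, (n <= m)%N ->
     `|trans_kernel b sigma h (v n i) x - trans_kernel b sigma h (v n i) y| <=
     C * (jap y * enorm (x - y))).

Local Notation X := (Xbar b sigma W h X0).
Local Notation X' := (Xhat b sigma W h X0 Proj).
Local Notation Y := (Ybar b sigma f g c W h m X0).
Local Notation Y' := (Yhat b sigma f g c P W h m X0 Gamma Proj).

Let mX k : measurable_fun setT (X k).
Proof. exact: (measurable_Xbar hF hW lb ls h0 mX0). Qed.

Let mProj k : (k <= m)%N -> measurable_fun setT (Proj k).
Proof. by move=> /hProj[]. Qed.

Let mX' k : (k <= m)%N -> measurable_fun setT (X' k).
Proof. by move=> km; exact: (measurableT_comp (mProj km) (mX k)). Qed.

Let X'_grid k omega : (k <= m)%N -> X' k omega \in (Gamma k : seq _).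
Proof. by move=> km; have [_ + _] := hProj km; apply. Qed.

Let m_cell k x : (k <= m)%N -> measurable (X' k @^-1` [set x]).
Proof.
move=> km; rewrite -[X in measurable X]setTI; apply: mX' => //.
exact: measurable_set1_cV.
Qed.

Definition dist_err k omega : R := enorm (X k omega - X' k omega).
Definition loc_err k omega : R := jap (X' k omega) * dist_err k omega.
(** The maximum over the regimes is taken inside the norm: the recursion then
    passes from one date to the next without a factor [q]. *)
Definition val_err k omega : R :=
  \big[Num.max/0]_(i < q) `|Y k i omega - Y' k i omega|.

Let loc_err_ge0 k omega : 0 <= loc_err k omega.
Proof. by rewrite mulr_ge0 ?jap_ge0 ?enorm_ge0. Qed.

Lemma dist_le_loc k omega : dist_err k omega <= loc_err k omega.
Proof. by rewrite ler_peMl ?enorm_ge0// jap_ge1. Qed.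

Let val_err_ge0 k omega : 0 <= val_err k omega.
Proof.
by apply: (big_ind (fun x => 0 <= x)) => // x y x0 y0; rewrite le_max x0.
Qed.

Lemma val_err_ge k i omega : `|Y k i omega - Y' k i omega| <= val_err k omega.
Proof. by rewrite /val_err (bigD1 i)//= le_max lexx. Qed.

Lemma val_err_le k omega M : 0 <= M ->
  (forall i, `|Y k i omega - Y' k i omega| <= M) -> val_err k omega <= M.
Proof.
move=> M0 hM; apply: (big_ind (fun x => x <= M)) => // x y xM yM.
by rewrite ge_max xM.
Qed.

Let m_dist k : (k <= m)%N -> measurable_fun setT (dist_err k).
Proof.
move=> km; apply: (measurableT_comp (@measurable_enorm R d)).
apply: measurable_cVP => i; under eq_fun do rewrite !mxE.
apply: measurable_funB.
  exact: (measurableT_comp (@measurable_coord _ _ _ i) (mX k)).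
exact: (measurableT_comp (@measurable_coord _ _ _ i) (mX' km)).
Qed.

Let m_jap k : (k <= m)%N -> measurable_fun setT (fun omega => jap (X' k omega)).
Proof.
by move=> km; apply: (measurableT_comp (@measurable_jap R d)); exact: mX'.
Qed.

Let m_loc k : (k <= m)%N -> measurable_fun setT (loc_err k).
Proof. by move=> km; apply: measurable_funM; [exact: m_jap|exact: m_dist]. Qed.

Let mY k i : measurable_fun setT (Y k i).
Proof. exact: (measurableT_comp (v_growth _ _).1 (mX k)). Qed.

Let mY' k i : (k <= m)%N -> measurable_fun setT (Y' k i).
Proof.
move=> km; apply: (@measurable_finite_valued _ _ _ _ (X' k) (Gamma k)).
- exact: fset_uniq.
- by move=> omega; exact: X'_grid.
- by move=> x; exact: m_cell.
Qed.

Lemma measurable_value_diff k i : (k <= m)%N ->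
  measurable_fun setT (fun omega => Y k i omega - Y' k i omega).
Proof. by move=> km; apply: measurable_funB; [exact: mY|exact: mY']. Qed.

Lemma measurable_val_err k : (k <= m)%N -> measurable_fun setT (val_err k).
Proof.
move=> km; rewrite /val_err; elim: (index_enum _) => [|i s IHs].
  by under eq_fun do rewrite big_nil; exact: measurable_cst.
under eq_fun do rewrite big_cons.
apply: measurable_maxr => //; apply: measurableT_comp => //.
exact: measurable_value_diff.
Qed.

Lemma val_err_terminal omega : val_err m omega <= C * loc_err m omega.
Proof.
apply: val_err_le => [|i]; first by rewrite mulr_ge0// ltW.
have := v_lip i (X m omega) (X' m omega) (leq0n m).
by rewrite /Ybar /Yhat /vbar /vhat subnn.
Qed.

Lemma quant_kernel_cell_mean k phi x : (k < m)%N ->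
  quant_kernel b sigma P W h X0 Gamma Proj k phi x =
  cell_mean P (X' k) (fun omega => phi (X' k.+1 omega)) x.
Proof.
move=> km; rewrite /cell_mean.
rewrite (@Rintegral_cell_finite_valued _ _ _ P _ (X' k) _ _ (X' k.+1)
  (Gamma k.+1)).
- rewrite mulr_suml; apply: eq_bigr => y _; rewrite /trans_weight mulrAC.
  by [].
- by move=> y; apply: m_cell; exact: ltnW.
- exact: fset_uniq.
- by move=> omega; exact: X'_grid.
- by move=> y; exact: m_cell.
Qed.

(** Both recursions maximize over the same regimes, so that it suffices to compare
    the continuation values. The exact one moves from the state to its projection
    at the price of a local error; on the cell of the projection, its mean is
    that of the value at the next date, which differs from the quantized value
    by at most [val_err k.+1]. *)
Lemma val_err_step k omega : (k < m)%N ->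
  0 < fine (P (X' k @^-1` [set X' k omega])) ->
  P.-integrable setT (EFin \o loc_err k) ->
  P.-integrable setT (EFin \o val_err k.+1) ->
  val_err k omega <= 3 * C * loc_err k omega +
    cell_mean P (X' k) (fun w => C * loc_err k w + val_err k.+1 w) (X' k omega).
Proof.
move=> km Ppos ie iD; have km' := ltnW km.
have CeD0 w : 0 <= C * loc_err k w + val_err k.+1 w.
  by rewrite addr_ge0// mulr_ge0// ltW.
set x := X' k omega in Ppos *.
apply: val_err_le => [|i].
  apply: addr_ge0; last exact: cell_mean_ge0.
  by apply: mulr_ge0 => //; rewrite mulr_ge0// ltW.
rewrite /Ybar /Yhat /vbar /vhat -(subnSK km) /= -/x.
rewrite (subnSK km) subKn//.
apply: maxreg_dist => j.
set U := trans_kernel b sigma h _; set phi := backward _ _ _ _ _ _ _ _.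
have kerX : `|U (X k omega) - U x| <= C * loc_err k omega.
  by apply: ker_lip; rewrite leq_subr.
have main : `|U x - quant_kernel b sigma P W h X0 Gamma Proj k phi x| <=
    cell_mean P (X' k) (fun w => C * loc_err k w + val_err k.+1 w) x.
  rewrite quant_kernel_cell_mean//.
  have mc : measurable (X' k @^-1` [set x]) by exact: m_cell.
  have iphi : P.-integrable setT (EFin \o (fun w => phi (X' k.+1 w))).
    apply: (@integrable_finite_valued _ _ _ P _ (X' k.+1) (Gamma k.+1)).
    - exact: fset_uniq.
    - by move=> w; exact: X'_grid.
    - by move=> y; exact: m_cell.
  (* The chain is not assumed integrable; the value at the next date is, being
     within the integrable [val_err k.+1] of a bounded variable. *)
  have iv : P.-integrable setT
      (EFin \o (v (m - k.+1) j \o X k.+1)).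
    have isum := integrableD measurableT (integrable_norm iphi) iD.
    apply: (le_integrable measurableT _ _ isum).
      apply/measurable_EFinP.
      exact: (measurableT_comp (v_growth _ _).1 (mX k.+1)).
    move=> w _; rewrite /= lee_fin [X in _ <= X]ger0_norm ?addr_ge0//.
    have := val_err_ge k.+1 j w; rewrite /Ybar /Yhat /vbar /vhat -/phi => hd.
    have := lerB_dist (v (m - k.+1) j (X k.+1 w)) (phi (X' k.+1 w)).
    move: hd; set A := `|_ - _|; set B := `|v _ _ _|; set D := `|phi _|.
    by move=> hd hB; change (B <= D + val_err k.+1 w); lra.
  have mB : measurable (Proj k @^-1` [set x]).
    rewrite -[X in measurable X]setTI; apply: mProj => //.
    exact: measurable_set1_cV.
  have [iU EU] := one_step_expectation hF hW lb ls h0 mX0 mB (v_growth _ j) iv.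
  have sub (H : Omega -> R) : P.-integrable setT (EFin \o H) ->
      P.-integrable (X' k @^-1` [set x]) (EFin \o H).
    by move=> iH; apply: integrableS iH.
  apply: (@cell_mean_compare _ _ _ P _ (X' k) _ (U \o X k)
    (v (m - k.+1) j \o X k.+1)) => //.
  - by move=> y; exact: m_cell.
  - exact: sub.
  - exact: sub.
  - by apply: sub; exact: (integrableZl measurableT C ie).
  - exact: sub.
  - move=> w wx; rewrite distrC -wx; apply: ker_lip.
    by rewrite leq_subr.
  - by move=> w wx; exact: val_err_ge.
have De : dist_err k omega <= loc_err k omega by exact: dist_le_loc.
have := f_lip j (X k omega) x; have := c_lip i j (X k omega) x.
rewrite -/(dist_err k omega) => hc hf.
have CDe : C * dist_err k omega <= C * loc_err k omega by rewrite ler_pM2l.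
have hhf : `|h * (f j (X k omega) - f j x)| <= C * loc_err k omega.
  rewrite normrM (gtr0_norm h0) -[X in _ <= X]mul1r ler_pM ?(ltW h0)//.
  exact: le_trans hf CDe.
have hhc := le_trans hc CDe.
set Qp := quant_kernel _ _ _ _ _ _ _ _ _ _ _ in main *.
have -> : U (X k omega) + h * f j (X k omega) - c i j (X k omega) -
    (Qp + h * f j x - c i j x) = (U (X k omega) - U x) + (U x - Qp) +
    h * (f j (X k omega) - f j x) + - (c i j (X k omega) - c i j x) by ring.
move: main kerX hhf hhc; set cm := cell_mean _ _ _ _.
set p1 := U _ - U _; set p2 := U _ - Qp; set p3 := h * _; set p4 := c _ _ _ - _.
move=> main kerX hhf hhc.
have := ler_normD (p1 + p2 + p3) (- p4); have := ler_normD (p1 + p2) p3.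
have := ler_normD p1 p2; rewrite normrN; lra.
Qed.

(** Conditional means do not increase the norm: the error of the next date enters
    with the factor 1. *)
Lemma normRV_val_err_step p k : (k < m)%N -> 1 < p ->
  (normRV P p (loc_err k) < +oo)%E ->
  (normRV P p (val_err k.+1) < +oo)%E ->
  (normRV P p (val_err k) <=
   (4 * C)%:E * normRV P p (loc_err k) + normRV P p (val_err k.+1))%E.
Proof.
move=> km p1 eoo Doo; have p0 : 0 < p by lra.
have km' := ltnW km; have me := m_loc km'; have mD := measurable_val_err km.
have ie := integrable_normRV p1 me eoo; have iD := integrable_normRV p1 mD Doo.
have C0' := ltW C0.
have mCe a : measurable_fun setT (fun w => a * loc_err k w).
  exact: measurable_funM.
pose Z w := C * loc_err k w + val_err k.+1 w.
have mZ : measurable_fun setT Z by exact: measurable_funD.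
have Z0 w : 0 <= Z w by rewrite addr_ge0// mulr_ge0.
have SG w : X' k w \in (Gamma k : seq _) by exact: X'_grid.
have mcell x : measurable (X' k @^-1` [set x]) by exact: m_cell.
have mM : measurable_fun setT (fun w => cell_mean P (X' k) Z (X' k w)).
  exact: (measurable_finite_valued (fset_uniq _) SG mcell).
have step : (normRV P p (val_err k) <= normRV P p
    (fun w => 3 * C * loc_err k w + cell_mean P (X' k) Z (X' k w))%R)%E.
  apply: le_normRV_ae => //; first exact: measurable_val_err.
    exact: measurable_funD.
  apply: filterS (ae_cell_gt0 P (fset_uniq _) SG mcell) => w Pw.
  rewrite (ger0_norm (val_err_ge0 k w)) (le_trans _ (ler_norm _))//.
  exact: val_err_step.
apply: (le_trans step).
apply: (le_trans (minkowski_EFin P (mCe (3 * C)) mM (ltW p1))).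
have n1 : ('N[P]_p%:E[EFin \o (fun w => 3 * C * loc_err k w)%R] =
    (3 * C)%:E * normRV P p (loc_err k))%E.
  by apply: normRVZ => //; rewrite mulr_ge0.
have n2 : (normRV P p (fun w => cell_mean P (X' k) Z (X' k w)) <=
    C%:E * normRV P p (loc_err k) + normRV P p (val_err k.+1))%E.
  apply: le_trans (normRV_cell_mean P (fset_uniq _) SG mcell p1 mZ Z0) _.
  apply: (le_trans (minkowski_EFin P (mCe C) mD (ltW p1))).
  by rewrite leeD2r// -[X in (_ <= X)%E]normRVZ.
rewrite n1; apply: (le_trans (leeD2l _ n2)).
have -> : (4 * C)%:E = ((3 * C)%:E + C%:E)%E by rewrite -EFinD; congr EFin; ring.
by rewrite ge0_muleDl ?addeA// lee_fin// mulr_ge0.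
Qed.

Lemma normRV_val_err p k : (k <= m)%N -> 1 < p ->
  (normRV P p (val_err k) <=
   (4 * C)%:E * \sum_(k <= l < m.+1) normRV P p (loc_err l))%E.
Proof.
move=> km p1; have p0 : 0 < p by lra.
have C40 : 0 <= 4 * C by rewrite mulr_ge0// ltW.
rewrite -(subKn km); move: (leq_subr k m); move: (m - k)%N => n {k km}.
elim: n => [|n IHn] nm.
  rewrite subn0 big_nat1 -normRVZ//; last exact: m_loc.
  apply: le_normRV => //; first exact: measurable_val_err.
    exact: measurable_funM (m_loc _).
  move=> w; rewrite ger0_norm// ger0_norm; last by rewrite mulr_ge0.
  apply: (le_trans (val_err_terminal w)).
  by have := mulr_ge0 (ltW C0) (loc_err_ge0 m w); lra.
have {}IHn := IHn (ltnW nm); rewrite -(subnSK nm) in IHn.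
set k := (m - n.+1)%N in IHn *.
have km : (k < m)%N by rewrite /k ltn_subrL /=; exact: leq_ltn_trans nm.
rewrite big_ltn; last exact: leqW.
set S := (\sum_(_ <= _ < _) _)%E in IHn *.
have S0 : (0 <= S)%E by apply: sume_ge0 => l _; exact: normRV_ge0.
have e0 := normRV_ge0 P p (loc_err k).
rewrite ge0_muleDr//.
(* If a norm is infinite, so is the right-hand side, because [C > 0]. *)
have [eoo|en] := eqVneq (normRV P p (loc_err k)) +oo%E.
  by rewrite eoo gt0_muley ?lte_fin ?mulr_gt0// addye ?leey// gt_eqF//
    (lt_le_trans (ltNyr 0))// mule_ge0.
have [Soo|Sn] := eqVneq S +oo%E.
  by rewrite Soo gt0_muley ?lte_fin ?mulr_gt0// addey ?leey// gt_eqF//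
    (lt_le_trans (ltNyr 0))// mule_ge0.
have Slt : ((4 * C)%:E * S < +oo)%E.
  by rewrite lte_mul_pinfty// ltey.
apply: (le_trans (normRV_val_err_step km p1 _ _)); first by rewrite ltey.
  exact: le_lt_trans Slt.
exact: leeD2l.
Qed.

Lemma normRV_loc_err p r s k : (k <= m)%N -> 1 < p -> 1 < r -> 1 < s ->
  p^-1 = r^-1 + s^-1 ->
  (normRV P p (loc_err k) <=
   (1 + normRVec P r X0 + normRVec P r (X' k)) *
   normRVec P s (X k \- X' k)%R)%E.
Proof.
move=> km p1 r1 s1 prs.
have p0 : 0 < p by lra.
have r0 : 0 < r by lra.
have s0 : 0 < s by lra.
have mj := m_jap km; have md := m_dist km.
apply: (le_trans (hoelder_normRV P p0 r0 s0 prs mj md)).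
rewrite [X in (_ * X <= _)%E](_ : _ = normRVec P s (X k \- X' k)%R)//.
apply: lee_wpmul2r; first exact: normRV_ge0.
have me : measurable_fun setT (fun w => enorm (X' k w)).
  exact: (measurableT_comp (@measurable_enorm R d) (mX' km)).
apply: (@le_trans _ _ (normRV P r (fun w => 1 + enorm (X' k w))%R)).
  apply: le_normRV => //; first exact: measurable_funD.
  move=> w; rewrite ger0_norm ?jap_ge0// ger0_norm ?addr_ge0 ?enorm_ge0//.
  exact: jap_le.
have mc1 : measurable_fun setT (cst 1 : Omega -> R) by [].
apply: (le_trans (minkowski_EFin P mc1 me (ltW r1))).
rewrite [X in (X + _)%E](_ : _ = 1%E); last exact: normRV_cst1.
by rewrite -addeA leeD2l// leeDr// normRV_ge0.
Qed.

End quantization_error.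

Unset Implicit Arguments.
Set Strict Implicit.
Set Printing Implicit Defensive.

Theorem theorem4p2 (R : realType) (T : R) (hT : 0 < T)
    (disp : measure_display) (Omega : measurableType disp)
    (P : probability Omega R)
    (F : R -> set (set Omega)) (hF : usual_filtration P F)
    (d q : nat) (hd : (0 < d)%N) (hq : (0 < q)%N)
    (W : R -> Omega -> 'cV[R]_d) (hW : brownian_motion P F W)
    (b : 'cV[R]_d -> 'cV[R]_d) (sigma : 'cV[R]_d -> 'M[R]_d)
    (f g : 'I_q -> 'cV[R]_d -> R) (c : 'I_q -> 'I_q -> 'cV[R]_d -> R)
    (hA : switching_assumptions b sigma f g c)
    (p r s : R) (hp : 1 < p) (hr : 1 < r) (hs : 1 < s)
    (hprs : p^-1 = r^-1 + s^-1) :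
  exists2 K : R, 0 < K &
    forall (m : nat) (h : R) (X0 : Omega -> 'cV[R]_d)
      (Gamma : nat -> {fset 'cV[R]_d}) (Proj : nat -> 'cV[R]_d -> 'cV[R]_d),
      (1 <= m)%N -> h = T / m%:R -> h <= 1 ->
      sub_measurable (F 0) X0 ->
      (forall k, (k <= m)%N -> nearest_proj (Gamma k) (Proj k)) ->
      let X := Xbar b sigma W h X0 in
      let X' := Xhat b sigma W h X0 Proj in
      let Y := Ybar b sigma f g c W h m X0 in
      let Y' := Yhat b sigma f g c P W h m X0 Gamma Proj in
      forall k, (k <= m)%N ->
        (\big[maxe/0]_(i < q) normRV P p (Y k i \- Y' k i)%R
         <= K%:E * \sum_(k <= l < m.+1)
              (1 + normRVec P r X0 + normRVec P r (X' l)) *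
              normRVec P s (X l \- X' l)%R)%E.
Proof.
have [[lb ls] _ _ _] := hA.
have [C C0 [f_lip c_lip v_growth v_reg]] := value_uniform_regularity T hA.
(* [C] may vanish, and the propagation requires a positive constant. *)
exists (4 * (C + 1)); first by rewrite mulr_gt0// ltr_wpDl.
move=> m h X0 Gamma Proj m1 hE h1 mX0 hProj X X' Y Y' k km.
have m0 : 0 < m%:R :> R by rewrite ltr0n.
have h0 : 0 < h by rewrite hE divr_gt0.
have hn n : (n <= m)%N -> h * n%:R <= T.
  move=> nm; rewrite hE -mulrA ger_pMr// mulrC ler_pdivrMr// mul1r.
  by rewrite ler_nat.
have C1 : 0 < C + 1 by rewrite ltr_wpDl.
have CC1 : C <= C + 1 by rewrite lerDl.
have weaken (a D : R) : 0 <= D -> a <= C * D -> a <= (C + 1) * D.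
  by move=> D0 /le_trans; apply; exact: ler_wpM2r.
have f_lip' j x y : `|f j x - f j y| <= (C + 1) * enorm (x - y).
  by apply: weaken (f_lip j x y); exact: enorm_ge0.
have c_lip' i j x y : `|c i j x - c i j y| <= (C + 1) * enorm (x - y).
  by apply: weaken (c_lip i j x y); exact: enorm_ge0.
have JD0 (x y : 'cV[R]_d) : 0 <= jap y * enorm (x - y).
  by rewrite mulr_ge0 ?jap_ge0 ?enorm_ge0.
have v_growth' n i := v_growth h m n i (ltW h0) h1.
have v_lip n i x y (nm : (n <= m)%N) := weaken _ _ (JD0 x y)
  (v_reg h m n i x y (ltW h0) h1 (hn n nm)).1.
have ker_lip n i x y (nm : (n <= m)%N) := weaken _ _ (JD0 x y)
  (v_reg h m n i x y (ltW h0) h1 (hn n nm)).2.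
have p0 : 0 < p by lra.
apply: (@le_trans _ _ (normRV P p
    (val_err P W b sigma f g c h m X0 Gamma Proj k))).
  apply: (big_ind (fun x => x <= _)%E) => [|x y xN yN|i _].
  - exact: normRV_ge0.
  - by rewrite ge_max xN.
  apply: le_normRV => //.
  - exact: (measurable_value_diff hF hW lb ls h0 mX0 hProj v_growth').
  - exact: (measurable_val_err hF hW lb ls h0 mX0 hProj v_growth').
  - move=> w; rewrite (le_trans _ (ler_norm _))//.
    exact: (val_err_ge P W b sigma f g c h m X0 Gamma Proj k i w).
apply: (le_trans (normRV_val_err hF hW lb ls h0 h1 mX0 hProj C1 f_lip' c_lip'
  v_growth' v_lip ker_lip km hp)).
apply: lee_wpmul2l; first by rewrite lee_fin mulr_ge0// ltW.
rewrite !big_nat; apply: lee_sum => l /andP[_ lm].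
exact: (normRV_loc_err hF hW lb ls h0 mX0 hProj lm hp hr hs hprs).
Qed.
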